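(* Let $\mathcal{X}$ be a (real or complex) Banach space with $\dim \mathcal{X}\geq 2$, let $\mathcal{N}$ be a nest on $\mathcal{X}$ such that each $N\in\mathcal{N}$ with $N_{-}=N$ is complemented in $\mathcal{X}$, and let $\delta: Alg\mathcal{N}\rightarrow Alg\mathcal{N}$ be a linear map. Then $\delta$ satisfies $$A,B\in Alg\mathcal{N},\ AB=0 \Longrightarrow A\delta(B)+\delta(A)B=0$$ if and only if there exist $S,T\in Alg\mathcal{N}$ such that $\delta(A)=AT-SA$ for all $A\in Alg\mathcal{N}$ and $T-S\in Z(Alg\mathcal{N})$.
   Context: A nest $\mathcal{N}$ on a Banach space $\mathcal{X}$ is a chain (under inclusion) of norm-closed subspaces of $\mathcal{X}$ containing $\{0\}$ and $\mathcal{X}$ such that for every family $\{N_i\}$ of elements of $\mathcal{N}$, both $\bigcap N_i$ and $\bigvee N_i$ (the closed linear span of the $N_i$) belong to $\mathcal{N}$. The nest algebra $Alg\mathcal{N}$ is the algebra of all bounded linear operators on $\mathcal{X}$ that leave every member of $\mathcal{N}$ invariant. For $N\in\mathcal{N}$, $N_{-}:=\bigvee\{M\in\mathcal{N} : M\subsetneq N\}$. $Z(\mathcal{A})$ denotes the centre of an algebra $\mathcal{A}$. Linear maps are linear over the scalar field of $\mathcal{X}$ and are not assumed continuous. *)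

(* Defs.v *)
From HB Require Import structures.
From mathcomp Require Import all_boot all_order all_algebra.
From mathcomp Require Import complex.
From mathcomp Require Import boolp classical_sets functions reals.
From mathcomp Require Import topology normedtype.

Set Implicit Arguments.
Unset Strict Implicit.
Unset Printing Implicit Defensive.

Import Order.TTheory GRing.Theory Num.Theory.
Import numFieldNormedType.Exports.

Local Open Scope classical_set_scope.
Local Open Scope ring_scope.

(* [R[i]] is the field of complex numbers over a model [R] of the reals. *)
Inductive real_or_complex : numFieldType -> Prop :=
| real_scalars (R : realType) : real_or_complex R
| complex_scalars (R : realType) : real_or_complex R[i].

Section Subspaces.
Variables (K : numFieldType) (X : normedModType K).
Implicit Types (A N : set X) (F : set (set X)).

(* There are two linearly independent vectors. *)
Definition dim_ge2 : Prop :=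
  exists x y : X, forall a b : K, a *: x + b *: y = 0 -> a = 0 /\ b = 0.

Definition subspace_set N : Prop :=
  N 0 /\ forall (a : K) x y, N x -> N y -> N (a *: x + y).

Definition closed_subspace N : Prop := subspace_set N /\ closed N.

Definition linear_span A : set X := smallest subspace_set A.

(* On the empty family this is the zero subspace. *)
Definition join F : set X := closure (linear_span (\bigcup_(N in F) N)).

Definition complemented N : Prop :=
  exists M : set X, [/\ closed_subspace M, N `&` M = [set 0] &
    forall x, exists y z, [/\ N y, M z & x = y + z]].

Record nest := Nest {
  nest_set :> set X -> Prop;
  nest_closed_subspace : forall N, nest_set N -> closed_subspace N;
  nest_chain : total_on nest_set subset;
  nest_zero : nest_set [set 0];
  nest_full : nest_set setT;
  nest_bigcap : forall F, F `<=` nest_set -> nest_set (\bigcap_(N in F) N);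
  nest_join : forall F, F `<=` nest_set -> nest_set (join F) }.

Definition nest_minus (NN : nest) N : set X := join [set M | NN M /\ M `<` N].

Definition bounded_operator (T : X -> X) : Prop :=
  linear T /\ exists C : K, forall x, `|T x| <= C * `|x|.

Definition nest_alg_pred (NN : nest) : {pred X -> X} := fun T =>
  `[< bounded_operator T /\ forall N, NN N -> T @` N `<=` N >].

Record nest_alg (NN : nest) := NestAlg {
  nest_alg_fun :> X -> X;
  nest_alg_funP : nest_alg_fun \in nest_alg_pred NN }.

End Subspaces.

Section NestAlgebra.
Variables (K : numFieldType) (X : normedModType K) (NN : nest X).

Lemma nest_alg_predP (T : X -> X) :
  reflect (bounded_operator T /\ forall N, NN N -> T @` N `<=` N)
          (T \in nest_alg_pred NN).
Proof. exact: asboolP. Qed.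

HB.instance Definition _ := [isSub for @nest_alg_fun K X NN].
HB.instance Definition _ := [Choice of nest_alg NN by <:].

Lemma nest_alg_submod_closed : submod_closed (nest_alg_pred NN).
Proof.
split=> [|a S T].
  apply/nest_alg_predP; split; first split.
  - by move=> a x y; rewrite [LHS]/= scaler0 addr0.
  - by exists 0 => x; rewrite [X in `|X|]/= normr0 mul0r.
  - by move=> N /nest_closed_subspace[[N0 _] _] _ [x _ <-].
move=> /nest_alg_predP[[Slin [s Ss]] SN] /nest_alg_predP[[Tlin [t Tt]] TN].
have E x : (a *: S + T) x = a *: S x + T x by [].
apply/nest_alg_predP; split; first split.
- move=> b x y; rewrite !E Slin Tlin !scalerDr !scalerA (mulrC a b).
  by rewrite addrACA.
- exists (`|a| * s + t) => x; rewrite E (le_trans (ler_normD _ _))//.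
  by rewrite normrZ mulrDl -mulrA lerD// ler_wpM2l.
- move=> N NNN; have [[_ Nlin] _] := nest_closed_subspace NNN.
  move=> _ [x Nx <-]; rewrite E; apply: Nlin.
  + by apply: (SN _ NNN); exists x.
  + by apply: (TN _ NNN); exists x.
Qed.

HB.instance Definition _ :=
  GRing.isSubmodClosed.Build K (X -> X) (nest_alg_pred NN)
    nest_alg_submod_closed.
HB.instance Definition _ := [SubChoice_isSubLmodule of nest_alg NN by <:].

Lemma nest_alg_pred_id : (id : X -> X) \in nest_alg_pred NN.
Proof.
apply/nest_alg_predP; split; first by split=> //; exists 1 => x; rewrite mul1r.
by move=> N _ _ [x Nx <-].
Qed.

Lemma nest_alg_pred_comp (S T : nest_alg NN) : S \o T \in nest_alg_pred NN.
Proof.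
have /nest_alg_predP[[Slin [s Ss]] SN] := nest_alg_funP S.
have /nest_alg_predP[[Tlin [t Tt]] TN] := nest_alg_funP T.
apply/nest_alg_predP; split; first split.
- by move=> a x y; rewrite /= Tlin Slin.
- exists (`|s| * t) => x /=; apply: (le_trans (Ss _)).
  apply: (@le_trans _ _ (`|s| * `|T x|)).
    have := le_trans (normr_ge0 _) (Ss (T x)).
    by move=> /ger0_norm <-; rewrite normrM normr_id.
  by rewrite -mulrA ler_wpM2l.
- move=> N NNN _ [x Nx <-]; apply: (SN _ NNN).
  by exists (T x) => //; apply: (TN _ NNN); exists x.
Qed.

Definition nest_alg_one : nest_alg NN := NestAlg nest_alg_pred_id.
Definition nest_alg_mul (S T : nest_alg NN) : nest_alg NN :=
  NestAlg (nest_alg_pred_comp S T).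

Let mulA : associative nest_alg_mul.
Proof. by move=> S T U; apply: val_inj. Qed.

Let mul1 : left_id nest_alg_one nest_alg_mul.
Proof. by move=> S; apply: val_inj. Qed.

Let mulr1 : right_id nest_alg_one nest_alg_mul.
Proof. by move=> S; apply: val_inj. Qed.

Let mulDl : left_distributive nest_alg_mul +%R.
Proof. by move=> S T U; apply: val_inj. Qed.

Let mulDr : right_distributive nest_alg_mul +%R.
Proof.
move=> S T U; apply: val_inj; apply/funext => x /=.
have /nest_alg_predP[[Slin _] _] := nest_alg_funP S.
by have := Slin 1 (T x) (U x); rewrite !scale1r.
Qed.

HB.instance Definition _ := GRing.Zmodule_isPzRing.Build (nest_alg NN)
  mulA mul1 mulr1 mulDl mulDr.

End NestAlgebra.

Definition centre (A : pzRingType) : set A := [set z | forall a, GRing.comm z a].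
Arguments centre A : clear implicits.

(* Main.v *)
Require Import Defs.
From HB Require Import structures.
From mathcomp Require Import all_boot all_order all_algebra.
From mathcomp Require Import complex.
From mathcomp Require Import boolp classical_sets functions reals.
From mathcomp Require Import topology normedtype.
From mathcomp Require Import ring lra.
Import Order.TTheory GRing.Theory Num.Theory.
Import numFieldNormedType.Exports.
Set Implicit Arguments.
Unset Strict Implicit.
Unset Printing Implicit Defensive.
Local Open Scope classical_set_scope.
Local Open Scope ring_scope.

(** Rank-one operators carry the proof.  Write N^- for the predecessor of a
member N of the nest.  The operator x (x) f : z |-> f(z) x belongs to the nest
algebra as soon as x lies in some member N and f vanishes on N^-.

Let phi(A, B) = A delta(B) + delta(A) B.  If P is idempotent, the zero products
A P (1 - P) B = 0 and A (1 - P) P B = 0 give phi(A P, B) = phi(A, P B) for all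
A and B.  The elements P with this property ([balanced]) are closed under linear
combinations and products, so they include every rank-one operator generated by
idempotents.  When N^- <> N, a vector of N
outside N^- provides the idempotents; when N^- = N, the bounded projection
onto the complemented member N does ([balanced_rank_one]).  These
rank-one operators R are stable under left multiplication, and A R = 0 for all
of them only if A = 0; this turns the balance relation into: delta(1) is central
and D(A) = delta(A) - A delta(1) is a derivation ([zero_product_derivation]).

It remains to prove that every derivation D is inner ([derivation_inner]).
For rank-one operators R and R', the operator R' S R is a scalar multiple of a
rank-one operator that does not depend on S, so
R' D(S) R = D(R' S R) - D(R') S R - R' S D(R) depends continuously on S.
Hence D has a closed graph and is continuous
([derivation_continuous]).  On a member N with N^- <> X, choose f vanishing on
N^- and y with f(y) = 1; then E(x) = D(x (x) f) y satisfies
E(T x) = T E(x) + D(T) x.  Two choices of (N, f, y) give maps whose difference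
commutes with the algebra on a member, hence is a scalar
([commuting_scalar]); normalising at a fixed vector makes all
choices agree.  Choosing (f, y) by the Riesz lemma, with |f| |y| at most 4,
bounds these maps uniformly by the continuity of D, so they extend from the
dense union of such members to a bounded S with D(T) = S T - T S
([core_commutator], [dense_extension]).  The relation itself forces S to
preserve each member ([commutator_invariant]).  Then
delta(A) = A (delta(1) - S) - (- S) A.

The functionals come from Hahn-Banach ([separation]), and the two automatic
continuity statements from one closed graph theorem
([gauge_closed_graph]). *)

(** * Hahn-Banach separation over the real and complex scalars *)

(** The scalars of the space may be complex while the functional is only
real-linear: real numbers act through [iota], and a partial functional is
encoded by its graph, so that Zorn's lemma applies to inclusion. *)
Section DominatedExtension.
Variables (K : numFieldType) (R : realType) (iota : {rmorphism R -> K}).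
Variables (X : lmodType K) (p : X -> R).
Hypothesis p_subadd : forall x y, p (x + y) <= p x + p y.
Hypothesis p_homog : forall r x, 0 <= r -> p (iota r *: x) = r * p x.

Definition dominated_graph (G : set (X * R)) : Prop :=
  (forall r x a y b, G (x, a) -> G (y, b) -> G (iota r *: x + y, r * a + b)) /\
  (forall x a, G (x, a) -> a <= p x).

(** A value c at z is compatible with the bound p exactly when
a - p (x - z) <= c <= p (y + z) - b for all (x, a) and (y, b) in G, and
subadditivity puts every lower bound below every upper bound. *)
Lemma dominated_graph_extend G z : G (0, 0) -> dominated_graph G ->
  exists G', [/\ dominated_graph G', G `<=` G' & exists c, G' (z, c)].
Proof.
move=> G0 [Glin Gdom].
have iota0 : iota 0 = 0 by rewrite rmorph0.
have iota1 : iota 1 = 1 by rewrite rmorph1.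
have Gsc r x a : G (x, a) -> G (iota r *: x, r * a).
  by move=> /Glin /(_ G0) => /(_ r); rewrite !addr0.
pose S := [set r | exists x a, G (x, a) /\ r = a - p (x - z)].
have Sub y b : G (y, b) -> ubound S (p (y + z) - b).
  move=> Gyb _ [x [a [Gxa ->]]].
  have := Gdom _ _ (Glin 1 _ _ _ _ Gxa Gyb).
  rewrite iota1 scale1r mul1r => ab.
  have := p_subadd (x - z) (y + z).
  have -> : x - z + (y + z) = x + y by rewrite addrACA addNr addr0.
  lra.
have S0 : S !=set0 by exists (0 - p (0 - z)); exists 0, 0.
(* the smallest admissible value at z *)
pose c := sup S.
have cub y b : G (y, b) -> c <= p (y + z) - b.
  by move=> Gyb; apply: ge_sup => //; apply: Sub.
have clb x a : G (x, a) -> a - p (x - z) <= c.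
  move=> Gxa; apply: ub_le_sup; last by exists x, a.
  by exists (p (0 + z) - 0); apply: Sub.
exists [set u | exists x a t, G (x, a) /\ u = (x + iota t *: z, a + t * c)].
split; last 2 first.
- by move=> [x a] Gxa; exists x, a, 0; rewrite iota0 scale0r mul0r !addr0.
- by exists c, 0, 0, 1; rewrite iota1 scale1r mul1r !add0r.
split.
  move=> r _ _ _ _ [x [a [t [Gx [-> ->]]]]] [y [b [s [Gy [-> ->]]]]].
  exists (iota r *: x + y), (r * a + b), (r * t + s); split; first exact: Glin.
  congr pair; last by ring.
  by rewrite scalerDr rmorphD rmorphM scalerDl scalerA addrACA.
move=> _ _ [x [a [t [Gx [-> ->]]]]].
have [t0|t0|->] := ltgtP t 0; last first.
- by rewrite iota0 scale0r mul0r !addr0; apply: Gdom.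
- have tn0 : t != 0 by rewrite gt_eqF.
  have /cub := Gsc t^-1 _ _ Gx; rewrite -(ler_pM2l t0).
  rewrite mulrBr mulrA mulfV// mul1r -p_homog ?(ltW t0)//.
  rewrite scalerDr scalerA -rmorphM mulfV// iota1 scale1r; lra.
- have s0 : 0 < - t by rewrite oppr_gt0.
  have sn0 : - t != 0 by rewrite gt_eqF.
  have /clb := Gsc (- t)^-1 _ _ Gx; rewrite -(ler_pM2l s0).
  rewrite mulrBr mulrA mulfV// mul1r -p_homog ?(ltW s0)//.
  rewrite scalerBr scalerA -rmorphM mulfV// iota1 scale1r rmorphN scaleNr opprK.
  lra.
Qed.

(** Single-valuedness of a dominated graph is automatic: if (x, a) and (x, b)
belong to it, then so do (0, a - b) and (0, b - a), and p 0 = 0. *)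
Lemma dominated_extension G0 : G0 (0, 0) -> dominated_graph G0 ->
  exists u : X -> R,
  [/\ forall r x y, u (iota r *: x + y) = r * u x + u y,
      forall x, u x <= p x & forall x a, G0 (x, a) -> u x = a].
Proof.
move=> G00 domG0.
pose P (H : set (X * R)) := dominated_graph (G0 `|` H).
have [|H [PH Hmax]] := @Zorn_bigcup _ P.
  move=> F FP Ftot.
  have one_set u v : (G0 `|` \bigcup_(H in F) H) u ->
      (G0 `|` \bigcup_(H in F) H) v ->
      (G0 u /\ G0 v) \/ exists2 H, F H & (G0 `|` H) u /\ (G0 `|` H) v.
    move=> [Gu|[H FH Hu]] [Gv|[H' FH' Hv]]; first by left.
    - by right; exists H' => //; split; [left|right].
    - by right; exists H => //; split; [right|left].
    - right; have [HH|HH] := Ftot _ _ FH FH'.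
        by exists H' => //; split; right => //; apply: HH.
      by exists H => //; split; right => //; apply: HH.
  have FU H : F H -> G0 `|` H `<=` G0 `|` \bigcup_(H in F) H.
    by move=> FH u [|Hu]; [left|right; exists H].
  split=> [r x a y b ux vy|x a ux].
    have [[Gu Gv]|[H FH [Hu Hv]]] := one_set _ _ ux vy.
      by left; apply: domG0.1.
    by apply: (FU H) => //; apply: (FP _ FH).1.
  have [[Gu _]|[H FH [Hu _]]] := one_set _ _ ux ux; first exact: domG0.2 Gu.
  exact: (FP _ FH).2 Hu.
set G := G0 `|` H in PH.
have Gtot z : exists c, G (z, c).
  have [G' [domG' GG' [c zc]]] := dominated_graph_extend z (or_introl G00 : G _) PH.
  apply: contrapT => nz; apply: (Hmax G').
    split; first by move=> u Hu; apply: GG'; right.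
    by move=> /(_ _ zc) Hz; apply: nz; exists c; right.
  suff E : G0 `|` G' = G' by rewrite /P E.
  by apply/setUidPr => u Gu; apply: GG'; left.
have [u Gu] := choice Gtot.
have Gfun x a b : G (x, a) -> G (x, b) -> a = b.
  have le a' b' : G (x, a') -> G (x, b') -> a' <= b'.
    move=> Ga Gb; have := PH.2 _ _ (PH.1 (-1) _ _ _ _ Gb Ga).
    rewrite rmorphN1 scaleN1r addNr.
    have -> : p 0 = 0 by rewrite -(scale0r 0) -(rmorph0 iota) p_homog// mul0r.
    lra.
  by move=> Ga Gb; apply/eqP; rewrite eq_le !le.
exists u; split=> [r x y|x|x a G0x].
- exact: (Gfun _ _ _ (Gu _) (PH.1 _ _ _ _ _ (Gu x) (Gu y))).
- exact: PH.2 (Gu x).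
- by apply: (Gfun x) => //; left.
Qed.

End DominatedExtension.

(** Common real half of the separation theorem: [iota] and [re] stand for the
identity maps of R, or for the inclusion of R in R[i] and the real part. *)
Section RealSeparation.
Variables (K : numFieldType) (R : realType) (iota : {rmorphism R -> K}).
Variables (re : {additive K -> R}) (X : normedModType K).
Hypothesis re_iota : forall r z, re (iota r * z) = r * re z.
Hypothesis re_le : forall z w : K, 0 <= w -> `|z| <= w -> re z <= re w.
Hypothesis re_norm : forall r, `|iota r| = iota `|r|.

(** The functional m + t y |-> re t is bounded by |m + t y| / d because
|m + t y| = |t| |y + m / t| >= |t| d. *)
Lemma real_separation (M : set X) y (d : K) : subspace_set M -> 0 < d ->
  (forall m, M m -> d <= `|y - m|) ->
  exists u : X -> R,
  [/\ forall r x z, u (iota r *: x + z) = r * u x + u z,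
      forall x, u x <= re (d^-1 * `|x|),
      forall m, M m -> u m = 0 & forall t : K, u (t *: y) = re t].
Proof.
move=> [M0 Mlin] d0 hd.
have MZ a m : M m -> M (a *: m) by move=> Mm; rewrite -[_ *: _]addr0; apply: Mlin.
have [||||u [ulin udom uG]] := @dominated_extension K R iota X
    (fun x => re (d^-1 * `|x|)) _ _
    [set g | exists m t, M m /\ g = (m + t *: y, re t)].
- move=> x z; rewrite -raddfD -mulrDr; apply: re_le.
    by rewrite mulr_ge0 ?invr_ge0 ?(ltW d0)// addr_ge0.
  rewrite normrM normr_id ger0_norm ?invr_ge0 ?(ltW d0)//.
  by rewrite ler_pM2l ?invr_gt0// ler_normD.
- move=> r x r0; rewrite normrZ re_norm ger0_norm// mulrCA.
  exact: re_iota.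
- exists 0, 0; split=> //; by rewrite scale0r addr0 raddf0.
- split.
    move=> r _ _ _ _ [m [t [Mm [-> ->]]]] [n [s [Mn [-> ->]]]].
    exists (iota r *: m + n), (iota r * t + s); split; first exact: Mlin.
    rewrite scalerDr scalerA scalerDl addrACA; congr pair.
    by rewrite raddfD; congr +%R; exact: esym (re_iota _ _).
  move=> _ _ [m [t [Mm [-> ->]]]]; apply: re_le.
    by rewrite mulr_ge0 ?invr_ge0 ?(ltW d0).
  have [->|t0] := eqVneq t 0.
    by rewrite normr0 mulr_ge0 ?invr_ge0 ?(ltW d0).
  rewrite ler_pdivlMl// mulrC.
  have -> : m + t *: y = t *: (y - (- t^-1) *: m).
    by rewrite scalerBr scalerA mulrN mulfV// scaleN1r opprK addrC.
  by rewrite normrZ ler_wpM2l// hd//; apply: MZ.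
exists u; split=> // [m Mm|t].
  by apply: uG; exists m, 0; rewrite scale0r addr0 raddf0.
by apply: uG; exists 0, t; rewrite add0r.
Qed.

End RealSeparation.


Lemma Re_additive (R : realType) : additive (@complex.Re R : R[i] -> R).
Proof. by move=> [a b] [c d]. Qed.
HB.instance Definition _ (R : realType) :=
  GRing.isAdditive.Build R[i] R (@complex.Re R : R[i] -> R) (@Re_additive R).

(** In the complex case f(x) = u(x) - i u(i x) recovers a complex-linear
functional from its real part u; bounding the two terms separately costs the
factor 2. *)
Theorem separation (K : numFieldType) (X : normedModType K) (M : set X) y (d : K) :
  real_or_complex K -> subspace_set M -> 0 < d ->
  (forall m, M m -> d <= `|y - m|) ->
  exists f : X -> K, [/\ scalar f, forall m, M m -> f m = 0, f y = 1 &
    forall x, `|f x| <= 2 * (d^-1 * `|x|)].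
Proof.
move=> hK; case: {K} hK X M y d => R X M y d Msub d0 hd.
  have [//||//|u [ulin udom uM uy]] :=
    @real_separation R R idfun idfun X _ _ _ M y d Msub d0 hd.
    by move=> z w w0 zw; apply: le_trans zw; apply: ler_norm.
  exists u; split=> //; first by have := uy 1; rewrite scale1r.
  move=> x; apply: (@le_trans _ _ (d^-1 * `|x|)).
    rewrite ler_norml udom andbT lerNl.
    have := ulin (-1) x 0; rewrite (uM 0 Msub.1) scaleN1r mulN1r !addr0.
    by move=> <-; have := udom (- x); rewrite normrN.
  rewrite mulr_natl mulr2n lerDl mulr_ge0// invr_ge0 ltW//.
have [|||u [ulin udom uM uy]] :=
  @real_separation _ R (real_complex R) (@complex.Re R : R[i] -> R) X _ _ _
    M y d Msub d0 hd.
- by move=> r [a b] /=; rewrite mul0r subr0.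
- move=> z w w0 zw.
  have := le_trans (normc_ge_Re z) zw; rewrite lecE/= => /andP[_].
  by apply: le_trans; apply: ler_norm.
- by move=> r; rewrite normc_def/= expr0n/= addr0 sqrtr_sqr.
have uD x z : u (x + z) = u x + u z.
  by have := ulin 1 x z; rewrite rmorph1 scale1r mul1r.
have u0 : u 0 = 0 by apply: uM; apply: Msub.1.
have uZ r x : u (real_complex R r *: x) = r * u x.
  by have := ulin r x 0; rewrite !addr0 u0 addr0.
have uN x : u (- x) = - u x.
  by have := uZ (-1) x; rewrite rmorphN1 scaleN1r mulN1r.
pose f x : R[i] := Complex (u x) (- u ('i%C *: x)).
have ii : 'i%C * 'i%C = -1 :> R[i] by rewrite -expr2 sqr_i.
have fD x z : f (x + z) = f x + f z.
  by rewrite /f scalerDr !uD opprD.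
have fi x : f ('i%C *: x) = 'i%C * f x.
  rewrite /f scalerA ii scaleN1r uN opprK.
  by apply/eqP; rewrite eq_complex/= !mul0r !mul1r !opprK !add0r !eqxx.
have fr (r : R) x : f (r%:C%C *: x) = r%:C%C * f x.
  rewrite /f scalerA mulrC -scalerA !uZ.
  by apply/eqP; rewrite eq_complex/= !mul0r subr0 addr0 mulrN !eqxx.
have fZ z x : f (z *: x) = z * f x.
  rewrite [z]complexE scalerDl fD -scalerA fi !fr.
  by rewrite mulrDl mulrA.
exists f; split.
- by move=> z x x'; rewrite fD fZ.
- move=> m Mm; rewrite /f !uM ?oppr0//.
  by rewrite -[_ *: _]addr0; apply: Msub.2 => //; apply: Msub.1.
- rewrite /f uy; have := uy 1; rewrite scale1r => -> /=.
  by rewrite oppr0.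
- have uabs x : `|u x|%:C%C <= d^-1 * `|x|.
    have pr : d^-1 * `|x| \is Num.real.
      by rewrite ger0_real// mulr_ge0// invr_ge0 ltW.
    rewrite -(RRe_real pr) lecR ler_norml udom andbT lerNl -uN.
    by have := udom (- x); rewrite normrN.
  move=> x; have -> : f x = (u x)%:C%C - 'i%C * (u ('i%C *: x))%:C%C.
    apply/eqP; rewrite eq_complex/=.
    by rewrite ?(mul0r, mul1r, mulr0, subr0, add0r, oppr0, addr0, sub0r) !eqxx.
  apply: (le_trans (ler_normB _ _)); rewrite mulr_natl mulr2n.
  have nC (r : R) : `|r%:C%C| = `|r|%:C%C :> R[i].
    by rewrite normc_def/= expr0n/= addr0 sqrtr_sqr.
  have ni : `|'i%C| = 1 :> R[i].
    by rewrite normc_def/= expr0n/= add0r expr1n sqrtr1.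
  apply: lerD; first by rewrite nC uabs.
  rewrite normrM ni mul1r nC; apply: (le_trans (uabs _)).
  by rewrite normrZ ni mul1r.
Qed.

(** * A closed graph theorem *)

Lemma real_or_complex_archi (K : numFieldType) (x : K) : real_or_complex K ->
  0 <= x -> exists n, x <= n%:R.
Proof.
move=> hK; case: {K} hK x => R x x0.
  by exists (Num.bound x); rewrite ltW// archi_boundP.
exists (Num.bound (complex.Re x)).
have xr : x \is Num.real by rewrite ger0_real.
rewrite -(RRe_real xr) -(rmorph_nat (real_complex R)) lecR ltW// archi_boundP//.
by move: x0; rewrite lecE/= => /andP[].
Qed.

(** The order of K is partial when K is complex; comparisons go through
real elements. *)
Lemma pos_lower_bound (K : numFieldType) (a b : K) : 0 < a -> 0 < b ->
  exists c, [/\ 0 < c, c <= a & c <= b].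
Proof.
move=> a0 b0; have [ab|/ltW ba] := real_leP (gtr0_real a0) (gtr0_real b0).
  by exists a.
by exists b.
Qed.

Lemma le_of_le_eps (K : numFieldType) (a b : K) : a \is Num.real -> b \is Num.real ->
  (forall e, 0 < e -> a <= b + e) -> a <= b.
Proof.
move=> ar br ab; have [//|ba] := real_leP ar br.
have h : 0 < (a - b) / 2 by rewrite divr_gt0// subr_gt0.
have := ab _ h; rewrite -subr_ge0.
have -> : b + (a - b) / 2 - a = - ((a - b) / 2) by field.
by rewrite oppr_ge0 => /le_gtF; rewrite h.
Qed.

Section Gauge.
Variable K : numFieldType.

(** [b x c] reads: the norm of x is at most c.  A relation replaces a
norm because the operator norm, being a supremum, is not directly available as
an element of K.  Completeness is stated for
sequences whose steps are halved, which is the form used by nested balls. *)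
Record gauge (E : lmodType K) := Gauge {
  gauge_rel :> E -> K -> Prop;
  gauge_ex : forall x, exists2 c, 0 < c & gauge_rel x c;
  gaugeZ : forall a x c, gauge_rel x c -> gauge_rel (a *: x) (`|a| * c);
  gaugeD : forall x y c d, gauge_rel x c -> gauge_rel y d ->
    gauge_rel (x + y) (c + d);
  gauge_le : forall x c d, c <= d -> gauge_rel x c -> gauge_rel x d;
  gauge_complete : forall (s : nat -> E) (rho : nat -> K),
    (forall k, 0 < rho k) -> (forall k, rho k.+1 <= rho k / 2) ->
    (forall k, gauge_rel (s k.+1 - s k) (rho k / 2)) ->
    exists l, forall k, gauge_rel (l - s k) (rho k) }.

Lemma gaugeN (E : lmodType K) (b : gauge E) x c : b x c -> b (- x) c.
Proof. by move=> /(gaugeZ (-1)); rewrite scaleN1r normrN1 mul1r. Qed.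

Lemma gaugeB (E : lmodType K) (b : gauge E) x y c d :
  b x c -> b y d -> b (x - y) (c + d).
Proof. by move=> bx /gaugeN; apply: gaugeD. Qed.

Lemma gauge0 (E : lmodType K) (b : gauge E) c : 0 <= c -> b 0 c.
Proof.
move=> c0; have [d _ /(gaugeZ 0)] := gauge_ex b 0.
by rewrite scale0r normr0 mul0r; apply: gauge_le.
Qed.

Hypothesis hK : real_or_complex K.
Variables (E F : lmodType K) (b : gauge E) (b' : gauge F) (T : E -> F).
Hypothesis Tlin : linear T.

Let TD x y : T (x + y) = T x + T y.
Proof. by have := Tlin 1 x y; rewrite !scale1r. Qed.
Let T0 : T 0 = 0.
Proof. by apply: (addrI (T 0)); rewrite -TD !addr0. Qed.
Let TZ a x : T (a *: x) = a *: T x.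
Proof. by have := Tlin a x 0; rewrite T0 !addr0. Qed.
Let TN x : T (- x) = - T x.
Proof. by rewrite -scaleN1r TZ scaleN1r. Qed.

(** Baire category: E is the union of the sets
A_n = [set x | b' (T x) n], so the closure of one of them contains a ball.
Otherwise one builds shrinking balls, the n-th one avoiding A_n; their common
point lies in no A_n. *)
Lemma gauge_baire : exists n eps, 0 < eps /\ forall x, b x eps ->
  forall eta, 0 < eta -> exists2 x', b' (T x') n%:R & b (x - x') eta.
Proof.
apply: contrapT => nex.
have far n eps : 0 < eps -> exists x eta,
    [/\ b x eps, 0 < eta & forall x', b' (T x') n%:R -> ~ b (x - x') eta].
  move=> eps0; apply: contrapT => nf; apply: nex; exists n, eps; split=> // x bx.
  move=> eta eta0; apply: contrapT => nx'; apply: nf; exists x, eta; split=> //.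
  by move=> x' Tx' bxx'; apply: nx'; exists x'.
pose P (q : nat * (E * K)) (s : E * K) :=
  [/\ 0 < s.2, s.2 <= q.2.2 / 2, b (s.1 - q.2.1) (q.2.2 / 2) &
    forall x', b' (T x') q.1%:R -> ~ b (s.1 - x') s.2].
have [g Pg] : exists g, forall q, 0 < q.2.2 -> P q (g q).
  suff /choice[g Pg] : forall q, exists s, 0 < q.2.2 -> P q s by exists g.
  move=> [n [c rho]] /=; have [r0|nr0] := pselect (0 < rho); last by exists (0, 0).
  have r20 : 0 < rho / 2 by rewrite divr_gt0.
  (* If balls around both c and c + x met A_n, then x would be close to a
     difference of two elements of A_n, which lies in A_(n + n). *)
  have [x [eta [bx eta0 fx]]] := far (n + n)%N _ r20.
  have [rho' [r'0 r'r r'eta]] := pos_lower_bound r20 (divr_gt0 eta0 (ltr0n _ 2)).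
  have [fc|nfc] := pselect (forall x', b' (T x') n%:R -> ~ b (c - x') rho').
    exists (c, rho') => _; split=> //=; first by rewrite subrr; apply/gauge0/ltW.
  exists (c + x, rho') => _; split=> //=; first by rewrite addrAC subrr add0r.
  move=> z bz bcz; apply: nfc => z' bz' bcz'.
  apply: (fx (z - z')); first by rewrite TD TN natrD; apply: gaugeB.
  apply: (gauge_le (c := rho' + rho')).
    by rewrite [eta]splitr lerD.
  have -> : x - (z - z') = (c + x - z) - (c - z').
    rewrite [in LHS]opprB [in RHS]opprD opprK -[c + x - z]addrA addrACA.
    by rewrite subrr add0r addrA addrAC.
  exact: gaugeB.
pose st := fix st k := if k is k'.+1 then g (k', st k') else (0 : E, 1 : K).
have st0 k : 0 < (st k).2.
  by elim: k => [|k /= IH] //=; have [] := Pg (k, st k) IH.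
have Pst k : P (k, st k) (st k.+1) by exact: (Pg (k, st k) (st0 k)).
have [||l Hl] := @gauge_complete _ b (fun k => (st k).1) (fun k => (st k).2) st0.
- by move=> k; have [] := Pst k.
- by move=> k; have [] := Pst k.
have [c c0 bl] := gauge_ex b' (T l).
have [n cn] := real_or_complex_archi hK (ltW c0).
have [_ _ _ /(_ l (gauge_le cn bl))] := Pst n; apply.
by rewrite -opprB; apply/gaugeN/Hl.
Qed.

(** By [gauge_baire] every x in a ball is a sum of corrections x'_k with
|x'_k| = O(2^-k) and |T x'_k| = O(2^-k).  The images sum to some y with
|y| <= 2 N, and closedness of the graph gives y = T x. *)
Lemma gauge_closed_graph :
  (forall y, (forall eta, 0 < eta -> exists e, b e eta /\ b' (y - T e) eta) ->
    y = 0) ->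
  exists2 C, 0 < C & forall x c, 0 < c -> b x c -> b' (T x) (C * c).
Proof.
move=> Tclosed; have [n [eps [eps0 dense]]] := gauge_baire.
pose N : K := n.+1%:R.
have N0 : 0 < N by rewrite ltr0n.
pose h k : K := 2^-1 ^+ k.
have h0 k : 0 < h k by rewrite exprn_gt0// invr_gt0.
have hS k : h k.+1 = h k / 2 by rewrite /h exprSr.
have near k x : b x (eps * h k) ->
    exists x', b' (T x') (N * h k) /\ b (x - x') (eps * h k.+1).
  move=> bx; have [|x' Tx' bx'] := dense ((h k)^-1 *: x) _
    (eps / 2) (divr_gt0 eps0 (ltr0n _ 2)).
    have := gaugeZ (h k)^-1 bx; rewrite gtr0_norm ?invr_gt0//.
    by rewrite mulrCA mulVf ?gt_eqF// mulr1.
  exists (h k *: x'); split.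
    have := gaugeZ (h k) Tx'; rewrite TZ gtr0_norm// mulrC; apply: gauge_le.
    by rewrite ler_pM2r// /N ler_nat.
  have := gaugeZ (h k) bx'; rewrite scalerBr scalerA mulfV ?gt_eqF// scale1r.
  by rewrite gtr0_norm// hS mulrCA.
have main x : b x eps -> b' (T x) (2 * N).
  move=> bx.
  have [g Pg] : exists g : nat * E -> E, forall q, b q.2 (eps * h q.1) ->
      b' (T (g q)) (N * h q.1) /\ b (q.2 - g q) (eps * h q.1.+1).
    suff /choice[g Pg] : forall q, exists x', b q.2 (eps * h q.1) ->
        b' (T x') (N * h q.1) /\ b (q.2 - x') (eps * h q.1.+1) by exists g.
    move=> [k z]; have [/near[x' ?]|nb] := pselect (b z (eps * h k)).
      by exists x'.
    by exists 0 => /nb.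
  (* e k is the remainder after k corrections *)
  pose e := fix e k := if k is k'.+1 then e k' - g (k', e k') else x.
  have be k : b (e k) (eps * h k).
    elim: k => [|k IH]; first by rewrite /h expr0 mulr1.
    by have [] := Pg (k, e k) IH.
  have [|||y Hy] := @gauge_complete _ b' (fun k => T (x - e k)) (fun k => 2 * N * h k).
  - by move=> k; rewrite !mulr_gt0.
  - by move=> k; rewrite hS mulrA.
  - move=> k; have [/= + _] := Pg (k, e k) (be k).
    have -> : T (x - e k.+1) - T (x - e k) = T (g (k, e k)).
      rewrite -TN -TD /= !opprB; congr T.
      by rewrite [LHS]addrA -[x + _ + _]addrA subrK addrAC subrr add0r.
    by have -> : 2 * N * h k / 2 = N * h k by field.
  have Ty : y = T x.
    apply/eqP; rewrite -subr_eq0; apply/eqP; apply: Tclosed => eta eta0.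
    have [k [k1 k2]] : exists k, eps * h k <= eta /\ 2 * N * h k <= eta.
      have c0 : 0 < (eps + 2 * N) / eta by rewrite divr_gt0// addr_gt0// mulr_gt0.
      have [m hm] := real_or_complex_archi hK (ltW c0).
      have hm1 : h m * m%:R <= 1.
        rewrite /h exprVn ler_pdivrMl ?exprn_gt0// mulr1 -natrX ler_nat.
        by rewrite ltnW// ltn_expl.
      have : (eps + 2 * N) * h m <= eta.
        move: hm; rewrite ler_pdivrMr// => /(ler_wpM2r (ltW (h0 m))) => /le_trans; apply.
        rewrite mulrAC mulrC [_%:R * _]mulrC ler_piMr// ltW//.
      rewrite mulrDl => le; exists m; split; apply: le_trans le.
        by rewrite lerDl !mulr_ge0// ltW.
      by rewrite lerDr mulr_ge0// ltW.
    exists (- e k); split; first exact/gaugeN/(gauge_le k1)/be.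
    have -> : y - T x - T (- e k) = y - T (x - e k).
      by rewrite TD opprD addrA.
    exact: gauge_le k2 (Hy k).
  have := Hy 0%N; rewrite /= subrr T0 subr0 Ty /h expr0 mulr1.
  by [].
exists (2 * N / eps); first by rewrite divr_gt0// mulr_gt0.
move=> x c c0 bx.
have /main : b ((eps / c) *: x) eps.
  have := gaugeZ (eps / c) bx; rewrite gtr0_norm ?divr_gt0//.
  by rewrite divfK// gt_eqF.
move=> /(gaugeZ (c / eps)); rewrite TZ scalerA.
rewrite (_ : c / eps * (eps / c) = 1); last by field; rewrite !gt_eqF.
rewrite scale1r gtr0_norm ?divr_gt0// [c / eps * _]mulrC mulrA.
by rewrite [2 * N * c / eps]mulrAC.
Qed.

End Gauge.

(** * Approximation and completeness in normed spaces *)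

Section Approximation.
Variables (K : numFieldType) (X : normedModType K).
Implicit Types (A N : set X) (x y v : X).

Lemma closure_approx A v :
  closure A v <-> forall e : K, 0 < e -> exists2 z, A z & `|v - z| < e.
Proof.
split=> [clA e e0|h B /nbhs_ballP[e /= e0 eB]].
  have [z [Az vz]] := clA _ (nbhsx_ballx v e e0).
  by exists z => //; move: vz; rewrite -ball_normE.
have [z Az vz] := h _ e0; exists z; split=> //; apply: eB.
by rewrite -ball_normE.
Qed.

Lemma closed_approx N v : closed N ->
  (forall e : K, 0 < e -> exists2 z, N z & `|v - z| < e) -> N v.
Proof. by move=> clN h; apply: clN; apply/closure_approx. Qed.

Lemma closed_dist N y : closed N -> ~ N y ->
  exists2 d : K, 0 < d & forall m, N m -> d <= `|y - m|.
Proof.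
move=> clN nNy; apply: contrapT => nd; apply: nNy; apply: closed_approx => // e e0.
apply: contrapT => nz; apply: nd; exists e => // m Nm.
have [//|lt] := real_leP (gtr0_real e0) (normr_real (y - m)).
by exfalso; apply: nz; exists m.
Qed.

End Approximation.

Section Completeness.
Variable K : numFieldType.
Hypothesis hK : real_or_complex K.

Lemma halving_small (rho : nat -> K) (D e : K) : (forall k, 0 < rho k) ->
  (forall k, rho k.+1 <= rho k / 2) -> 0 <= D -> 0 < e ->
  exists k0, forall k, (k0 <= k)%N -> rho k * D < e.
Proof.
move=> rho0 rhoS D0 e0.
have dec k j : rho (k + j)%N <= rho k.
  elim: j => [|j IH]; first by rewrite addn0.
  rewrite addnS; apply: (le_trans (rhoS _)); apply: (le_trans _ IH).
  by rewrite ler_pdivrMr// ler_peMr ?ler1n ?(ltW (rho0 _)).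
have pow k : rho k * k.+1%:R <= rho 0%N * 1.
  elim: k => [//|k]; apply: le_trans.
  apply: (le_trans (ler_wpM2r (ler0n _ _) (rhoS k))).
  rewrite -mulrA ler_wpM2l ?(ltW (rho0 _))// ler_pdivrMl// -natrM ler_nat.
  by rewrite mul2n -addnn addSnnS leq_addl.
have c0 : 0 <= rho 0%N * D / e by rewrite divr_ge0 ?mulr_ge0// ltW.
have [n hn] := real_or_complex_archi hK c0.
exists n => k nk; apply: (@le_lt_trans _ _ (rho n * D)).
  by rewrite ler_wpM2r// -(subnKC nk) dec.
rewrite -(@ltr_pM2r _ n.+1%:R) ?ltr0Sn// mulrAC.
apply: (le_lt_trans (ler_wpM2r D0 (pow n))); rewrite mulr1.
move: hn; rewrite ler_pdivrMr// [_ * e]mulrC => /le_lt_trans; apply.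
by rewrite ltr_pM2l// ltr_nat.
Qed.

Lemma eq0_of_halving (X : normedModType K) (rho : nat -> K) (D : K) (z : X) :
  (forall k, 0 < rho k) -> (forall k, rho k.+1 <= rho k / 2) ->
  (forall k, `|z| <= rho k * D) -> z = 0.
Proof.
move=> rho0 rhoS zk; apply/eqP; rewrite -normr_eq0; apply/negPn/negP => z0.
have {}z0 : 0 < `|z| by rewrite lt_def z0 normr_ge0.
have D0 : 0 <= D by rewrite -(pmulr_rge0 _ (rho0 0%N)) (le_trans _ (zk _)).
have [k /(_ k (leqnn _))] := halving_small rho0 rhoS D0 z0.
by move=> /(le_lt_trans (zk k)); rewrite ltxx.
Qed.

(** The factor D lets the same statement serve for vectors (D = 1) and for
operators evaluated at v (D = |v|). *)
Lemma norm_complete (X : completeNormedModType K) (s : nat -> X)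
    (rho : nat -> K) (D : K) : 0 <= D ->
  (forall k, 0 < rho k) -> (forall k, rho k.+1 <= rho k / 2) ->
  (forall k, `|s k.+1 - s k| <= rho k / 2 * D) ->
  exists l, forall k, `|l - s k| <= rho k * D.
Proof.
move=> D0 rho0 rhoS sS.
(* rho k / 2 <= rho k - rho k.+1, so the steps telescope *)
have tele k j : `|s (k + j)%N - s k| <= (rho k - rho (k + j)%N) * D.
  elim: j => [|j IH]; first by rewrite addn0 !subrr normr0 mul0r.
  rewrite addnS -(subrKA (s (k + j)%N)); apply: (le_trans (ler_normD _ _)).
  rewrite addrC -[X in X * D](subrKA (rho (k + j)%N)) mulrDl lerD//.
  apply: (le_trans (sS _)); rewrite ler_wpM2r// lerBrDr.
  by rewrite [X in _ <= X]splitr lerD2l.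
have cau k m : (k <= m)%N -> `|s m - s k| <= rho k * D.
  move=> km; have := tele k (m - k)%N; rewrite subnKC// => /le_trans; apply.
  by rewrite ler_wpM2r// gerBl ltW.
have /cauchy_cvg/cvg_ex[l /= sl] : cauchy (s @ \oo).
  apply: cauchy_exP => e e0.
  have [k hk] := halving_small rho0 rhoS D0 e0.
  exists (s k); exists k => // m /= km; rewrite -ball_normE /= distrC.
  by apply: (le_lt_trans (cau _ _ km)); apply: hk.
exists l => k; apply: le_of_le_eps; rewrite ?normr_real//.
  by rewrite ger0_real// mulr_ge0// ltW.
move=> e e0; move/cvgrPdist_lt: sl => /(_ _ e0)[m _ lm].
have {lm} := lm (maxn k m) (leq_maxr _ _) => /= lm.
rewrite -(subrKA (s (maxn k m))) addrC; apply: (le_trans (ler_normD _ _)).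
by rewrite lerD// ?cau ?leq_maxl// ltW.
Qed.

Definition norm_gauge (X : completeNormedModType K) : gauge X.
Proof.
apply: (@Gauge K X (fun x c => `|x| <= c)).
- by move=> x; exists (`|x| + 1); rewrite ?ltr_wpDl// lerDl.
- by move=> a x c xc; rewrite normrZ ler_wpM2l.
- by move=> x y c d xc yd; apply: (le_trans (ler_normD _ _)); apply: lerD.
- by move=> x c d cd xc; apply: le_trans cd.
- move=> s rho rho0 rhoS sS; have [|l hl] := norm_complete (@ler01 K) rho0 rhoS (s := s).
    by move=> k; rewrite mulr1.
  by exists l => k; rewrite -[rho k]mulr1.
Defined.

End Completeness.

(** * Bounded functionals, nests and rank-one operators *)

Section Functionals.
Variables (K : numFieldType) (X : normedModType K).

Record functional := Functional {
  functional_fun :> X -> K;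
  functional_linear : scalar functional_fun;
  functional_bounded : exists c, forall x, `|functional_fun x| <= c * `|x| }.

Definition kills (f : functional) (N : set X) := forall z, N z -> f z = 0.

Implicit Types (f g : functional) (N M : set X).

Lemma functionalD f x y : f (x + y) = f x + f y.
Proof. by have := functional_linear f 1 x y; rewrite scale1r mul1r. Qed.

Lemma functional0 f : f 0 = 0.
Proof. by apply: (addrI (f 0)); rewrite -functionalD !addr0. Qed.

Lemma functionalZ f a x : f (a *: x) = a * f x.
Proof. by have := functional_linear f a x 0; rewrite functional0 !addr0. Qed.

Lemma functionalB f x y : f (x - y) = f x - f y.
Proof. by rewrite -scaleN1r functionalD functionalZ mulN1r. Qed.

Lemma bound_ge0 (V W : normedModType K) (h : V -> W) :
  (exists c, forall x, `|h x| <= c * `|x|) ->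
  exists2 c, 0 < c & forall x, `|h x| <= c * `|x|.
Proof.
move=> [c hc]; exists (`|c| + 1); first by rewrite ltr_wpDl.
move=> x; have [->|x0] := eqVneq x 0.
  by have := hc 0; rewrite normr0 !mulr0.
apply: (le_trans (hc x)); rewrite ler_wpM2r//.
have c0 : 0 <= c.
  by rewrite -(pmulr_lge0 _ (_ : 0 < `|x|)) ?normr_gt0// (le_trans _ (hc x)).
by rewrite ger0_norm// lerDl.
Qed.

Hypothesis hK : real_or_complex K.

Lemma closed_subspace_separation N y : closed_subspace N -> ~ N y ->
  exists2 f, kills f N & f y = 1.
Proof.
move=> [subN clN] /(closed_dist clN)[d d0 hd].
have [f [flin fN fy fb]] := separation hK subN d0 hd.
have fbd : exists c, forall x, `|f x| <= c * `|x|.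
  by exists (2 * d^-1) => x; rewrite -mulrA.
by exists (Functional flin fbd).
Qed.

(** If no such vector existed, every y outside N could be replaced by some
y - m with m in N and half the norm; iterating from y0 would bring N arbitrarily
close to y0.  This avoids
infima of distances, which the complex field K does not provide. *)
Lemma riesz_vector N : closed_subspace N -> (exists y, ~ N y) ->
  exists2 y, ~ N y & forall m, N m -> `|y| / 2 <= `|y - m|.
Proof.
move=> [[N0 Nlin] clN] [y0 Ny0]; apply: contrapT => nr.
have shrink y : ~ N y -> exists2 m, N m & `|y - m| <= `|y| / 2.
  move=> Ny; apply: contrapT => nm; apply: nr; exists y => // m Nm.
  have yr : `|y| / 2 \is Num.real by rewrite ger0_real// divr_ge0.
  have [//|lt] := real_leP yr (normr_real (y - m)).
  by exfalso; apply: nm; exists m => //; apply: ltW.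
have NB u v : N u -> N v -> N (u + v).
  by move=> Nu Nv; rewrite -[u]scale1r; apply: Nlin.
have NN1 u : N u -> N (- u).
  by move=> Nu; rewrite -scaleN1r -[_ *: _]addr0; apply: Nlin.
have small k : exists2 m, N m & `|y0 - m| <= `|y0| / 2 ^+ k.
  elim: k => [|k [m Nm hm]]; first by exists 0 => //; rewrite subr0 divr1.
  have [|n Nn hn] := shrink (y0 - m).
    by move=> Nym; apply: Ny0; rewrite -(subrK m y0); apply: NB.
  exists (m + n); first exact: NB.
  rewrite opprD addrA; apply: (le_trans hn).
  by rewrite exprSr invfM mulrA ler_wpM2r// invr_ge0.
have [d d0 hd] := closed_dist clN Ny0.
have [n hn] := real_or_complex_archi hK (divr_ge0 (normr_ge0 y0) (ltW d0)).
have [m Nm hm] := small n.+1.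
have := le_trans (hd _ Nm) hm; rewrite ler_pdivlMr ?exprn_gt0// => le1.
move: hn; rewrite ler_pdivrMr// => /(le_trans le1); rewrite mulrC ler_pM2r//.
have n2 : (n < 2 ^ n.+1)%N by apply: ltn_trans (ltn_expl _ _).
by rewrite -natrX ler_nat leqNgt n2.
Qed.

Lemma riesz_functional N : closed_subspace N -> (exists y, ~ N y) ->
  exists f y, [/\ kills f N, f y = 1 & forall x, `|f x| * `|y| <= 4 * `|x|].
Proof.
move=> cN /(riesz_vector cN)[y Ny hy]; have [subN clN] := cN.
have y0 : 0 < `|y|.
  by rewrite normr_gt0; apply: contra_notN Ny => /eqP ->; apply: subN.1.
have d0 : 0 < `|y| / 2 by rewrite divr_gt0.
have [f [flin fN fy fb]] := separation hK subN d0 hy.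
have fbd : exists c, forall x, `|f x| <= c * `|x|.
  by exists (2 * (`|y| / 2)^-1) => x; rewrite -mulrA.
exists (Functional flin fbd), y; split=> // x /=.
rewrite -ler_pdivlMr//; apply: (le_trans (fb x)).
have -> : 2 * ((`|y| / 2)^-1 * `|x|) = 4 * `|x| / `|y|.
  by field; rewrite gt_eqF.
by [].
Qed.

End Functionals.

Section Nests.
Variables (K : numFieldType) (X : normedModType K) (NN : nest X).
Hypothesis hK : real_or_complex K.
Implicit Types (L M N : set X).
Local Notation "N ^-" := (nest_minus NN N) (at level 1, format "N ^-").

Lemma join_sub (F : set (set X)) N : closed_subspace N ->
  (forall M, F M -> M `<=` N) -> join F `<=` N.
Proof.
move=> [subN clN] FN v /closure_approx h; apply: closed_approx => // e /h[z zF vz].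
exists z => //; apply: zF; split=> // u [M FM Mu]; exact: FN FM _ Mu.
Qed.

Lemma sub_join (F : set (set X)) M : F M -> M `<=` join F.
Proof. by move=> FM x Mx; apply: subset_closure => A [_]; apply; exists M. Qed.

Lemma nest_sub_or_proper M N : NN M -> NN N -> N `<=` M \/ M `<` N.
Proof.
move=> NM NN'; have [|MN] := pselect (N `<=` M); first by left.
by right; split=> //; have [//|/MN] := nest_chain NM NN'.
Qed.

Lemma minus_in N : NN N -> NN N^-.
Proof. by move=> hN; apply: nest_join => M []. Qed.

Lemma minus_sub N : NN N -> N^- `<=` N.
Proof.
move=> hN; apply: join_sub; first exact: nest_closed_subspace hN.
by move=> M [_ []].
Qed.

Lemma proper_sub_minus M N : NN M -> M `<` N -> M `<=` N^-.
Proof. by move=> hM MN; apply: sub_join. Qed.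

(** Let P be the intersection of the members strictly above M.  If P = M it
suffices that L^- is contained in L; otherwise P is the successor of M, so
that P^- is contained in M. *)
Lemma mem_of_minus M v : NN M ->
  (forall L, NN L -> M `<` L -> L^- v) -> M v.
Proof.
move=> hM hv; pose P := \bigcap_(L in [set L | NN L /\ M `<` L]) L.
have hP : NN P by apply: nest_bigcap => L [].
have [PM|MP] := nest_sub_or_proper hM hP.
  by apply: PM => L [hL ML]; apply: (minus_sub hL); apply: hv.
suff : P^- `<=` M by apply; apply: hv.
apply: join_sub; first exact: nest_closed_subspace hM.
move=> L [hL LP]; have [//|ML] := nest_sub_or_proper hM hL.
by case: LP => _ []; move=> x; apply.
Qed.

(** The functionals that occur in rank-one operators of the algebra separate
points: this is [mem_of_minus] at the member 0. *)
Lemma functionals_total v :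
  (forall (f : functional X) L, NN L -> (exists2 z, L z & z != 0) ->
    kills f L^- -> f v = 0) -> v = 0.
Proof.
move=> hv; apply: (mem_of_minus (nest_zero NN)) => L hL [_ L0].
apply: contrapT => nv.
have [f fL fv] := closed_subspace_separation hK (nest_closed_subspace (minus_in hL)) nv.
have /eqP : f v = 0.
  apply: (hv f L) => //; apply: contrapT => nz; apply: L0 => z Lz.
  by apply: contrapT => z0; apply: nz; exists z => //; apply/eqP.
by rewrite fv oner_eq0.
Qed.

(** The vectors x for which the algebra contains x (x) f for some nonzero f. *)
Definition core : set X := [set x | exists N, [/\ NN N, exists y, ~ N^- y & N x]].

Lemma core_pair x y : core x -> core y ->
  exists N, [/\ NN N, exists y, ~ N^- y, N x & N y].
Proof.
move=> [M [hM Mm Mx]] [N [hN Nm Ny]].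
by have [MN|NM] := nest_chain hM hN;
  [exists N|exists M]; split=> //; [apply: MN|apply: NM].
Qed.

Lemma core_subspace : (exists x : X, x != 0) -> subspace_set core.
Proof.
move=> [x0 nx0]; split.
  exists [set 0]; split=> //; first exact: nest_zero.
  exists x0 => /(minus_sub (nest_zero NN)) /= xE.
  by rewrite xE eqxx in nx0.
move=> a x y cx cy; have [N [hN Nm Nx Ny]] := core_pair cx cy.
by exists N; split=> //; apply: (nest_closed_subspace hN).1.2.
Qed.

(** If the predecessor of X is proper, the core is X; otherwise X is the join
of its proper members, each of which lies in the core. *)
Lemma core_dense : (exists x : X, x != 0) ->
  forall x (e : K), 0 < e -> exists2 z, core z & `|x - z| < e.
Proof.
move=> ex x e e0.
have [nx|full] := pselect (exists y, ~ setT^- y).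
  by exists x; rewrite ?subrr ?normr0//; exists setT; split=> //; apply: nest_full.
have /closure_approx/(_ e e0)[z zF xz] : setT^- x.
  by apply: contrapT => nx; apply: full; exists x.
exists z => //; apply: zF; split; first exact: core_subspace.
move=> u [M [hM MT] Mu]; exists M; split=> //.
apply: contrapT => nM; case: MT => _; apply => y _.
by apply: (minus_sub hM); apply: contrapT => ny; apply: nM; exists y.
Qed.

End Nests.

Section NestAlgebraTheory.
Variables (K : numFieldType) (X : normedModType K) (NN : nest X).
Implicit Types (A B : nest_alg NN).
Local Notation "N ^-" := (nest_minus NN N) (at level 1, format "N ^-").

Lemma nest_alg_ext A B : (forall v, A v = B v) -> A = B.
Proof. by move=> AB; apply: val_inj; apply/funext. Qed.

Lemma nest_algP A : bounded_operator A /\ forall N, NN N -> A @` N `<=` N.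
Proof. by apply/nest_alg_predP; apply: nest_alg_funP. Qed.

Lemma nest_algD A x y : A (x + y) = A x + A y.
Proof. by have [[Alin _] _] := nest_algP A; have := Alin 1 x y; rewrite !scale1r. Qed.

Lemma nest_alg0 A : A 0 = 0.
Proof. by apply: (addrI (A 0)); rewrite -nest_algD !addr0. Qed.

Lemma nest_algZ A a x : A (a *: x) = a *: A x.
Proof.
by have [[Alin _] _] := nest_algP A; have := Alin a x 0; rewrite nest_alg0 !addr0.
Qed.

Lemma nest_algB A x y : A (x - y) = A x - A y.
Proof. by rewrite -scaleN1r nest_algD nest_algZ scaleN1r. Qed.

Lemma nest_alg_bound A : exists2 c, 0 < c & forall x, `|A x| <= c * `|x|.
Proof. by have [[_ ?] _] := nest_algP A; apply: bound_ge0. Qed.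

Lemma nest_alg_inv A N x : NN N -> N x -> N (A x).
Proof. by move=> hN Nx; have [_ /(_ N hN)] := nest_algP A; apply; exists x. Qed.

Lemma add_algE A B v : (A + B) v = A v + B v. Proof. by []. Qed.
Lemma opp_algE A v : (- A) v = - A v. Proof. by []. Qed.
Lemma scale_algE a A v : (a *: A) v = a *: A v. Proof. by []. Qed.
Lemma mul_algE A B v : (A * B) v = A (B v). Proof. by []. Qed.
Lemma zero_algE v : (0 : nest_alg NN) v = 0. Proof. by []. Qed.
Lemma one_algE v : (1 : nest_alg NN) v = v. Proof. by []. Qed.
Definition algE := (add_algE, opp_algE, scale_algE, mul_algE, zero_algE, one_algE).

Definition admissible (x : X) (f : functional X) :=
  exists2 N, NN N & N x /\ kills f N^-.

(** The operator x (x) f; the default value 0 is taken only off the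
[admissible] pairs. *)
Definition rank_one (x : X) (f : functional X) : nest_alg NN :=
  insubd 0 (fun z => f z *: x).

(** A member M contains N, and then x; or it is strictly smaller, and then it
lies in N^-, where f vanishes. *)
Lemma rank_oneE x f z : admissible x f -> rank_one x f z = f z *: x.
Proof.
move=> [N hN [Nx fN]]; suff h : (fun z => f z *: x) \in nest_alg_pred NN.
  by rewrite -[rank_one x f z]/(val (insubd _ _) z) val_insubd h.
apply/nest_alg_predP; split; first split.
- by move=> a u v; rewrite functionalD functionalZ scalerDl scalerA.
- have [c hc] := functional_bounded f; exists (c * `|x|) => u.
  by rewrite normrZ mulrAC ler_wpM2r.
- move=> M hM _ [u Mu <-]; have [_ Mlin] := (nest_closed_subspace hM).1.
  have [M0 _] := (nest_closed_subspace hM).1.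
  have [NM|MN] := nest_sub_or_proper hM hN.
    by rewrite -[_ *: _]addr0; apply: Mlin => //; apply: NM.
  by rewrite fN ?scale0r//; apply: proper_sub_minus MN _ Mu.
Qed.

End NestAlgebraTheory.

(** * Balanced elements of a ring *)

Section ZeroProducts.
Variables (R : pzRingType) (delta : {additive R -> R}).
Implicit Types A B P : R.

Definition zero_product_derivable :=
  forall A B, A * B = 0 -> A * delta B + delta A * B = 0.

(** P may be moved across the pairing (A, B) |-> A delta(B) + delta(A) B. *)
Definition balanced P := forall A B,
  A * P * delta B + delta (A * P) * B = A * delta (P * B) + delta A * (P * B).

Lemma balancedD P Q : balanced P -> balanced Q -> balanced (P + Q).
Proof.
move=> bP bQ A B; rewrite !(mulrDl, mulrDr, raddfD) addrACA bP bQ.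
by rewrite addrACA.
Qed.

Lemma balancedN P : balanced P -> balanced (- P).
Proof.
move=> bP A B; rewrite mulrN mulNr raddfN mulNr -opprD bP.
by rewrite !(mulNr, mulrN, raddfN) -opprD.
Qed.

Lemma balancedM P Q : balanced P -> balanced Q -> balanced (P * Q).
Proof.
move=> bP bQ A B; rewrite [in LHS]mulrA bQ bP.
by rewrite !mulrA.
Qed.

Hypothesis delta0 : zero_product_derivable.

(** Apply the hypothesis to (A P) (B - P B) = 0 and to (A - A P) (P B) = 0, and
eliminate A P delta(P B) + delta(A P) P B. *)
Lemma balanced_idempotent P : P * P = P -> balanced P.
Proof.
move=> PP A B.
have h1 : A * P * (B - P * B) = 0 by rewrite mulrBr !mulrA -(mulrA A P P) PP subrr.
have h2 : (A - A * P) * (P * B) = 0.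
  by rewrite mulrBl !mulrA -(mulrA A P P) PP subrr.
have /eqP := delta0 h1.
rewrite raddfB /= !mulrBr addrACA -opprD subr_eq0 => /eqP ->.
have /eqP := delta0 h2.
by rewrite raddfB /= !mulrBl addrACA -opprD subr_eq0 => /eqP ->.
Qed.

(** Both P and P + Q are idempotent. *)
Lemma balanced_corner P Q : P * P = P -> P * Q = Q -> Q * P = 0 -> balanced Q.
Proof.
move=> PP PQ QP; have QQ : Q * Q = 0 by rewrite -{2}PQ mulrA QP mul0r.
rewrite -(addKr P Q); apply: balancedD.
  exact/balancedN/balanced_idempotent.
apply: balanced_idempotent.
by rewrite mulrDl !mulrDr PP PQ QP QQ !addr0.
Qed.

Lemma balanced_corner_op P Q : P * P = P -> Q * P = Q -> P * Q = 0 -> balanced Q.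
Proof.
move=> PP QP PQ; have QQ : Q * Q = 0 by rewrite -{1}QP -mulrA PQ mulr0.
rewrite -(addKr P Q); apply: balancedD.
  exact/balancedN/balanced_idempotent.
apply: balanced_idempotent.
by rewrite mulrDl !mulrDr PP PQ QP QQ !addr0.
Qed.

(** Balanced elements, stable under left multiplication, that separate the
elements of R acting on them; rank-one operators are the intended case. *)
Variable I : R -> Prop.
Hypothesis I_balanced : forall P, I P -> balanced P.
Hypothesis I_left : forall A P, I P -> I (A * P).
Hypothesis I_faithful : forall A, (forall P, I P -> A * P = 0) -> A = 0.

Let delta1_comm P : I P -> delta 1 * P = P * delta 1.
Proof.
move=> /I_balanced/(_ 1 1); rewrite !(mul1r, mulr1) addrC => /addrI.
by move=> ->.
Qed.

Let delta_mulI A P : I P -> delta (A * P) = A * delta P + delta A * P - A * P * delta 1.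
Proof.
by move=> /I_balanced/(_ A 1); rewrite !mulr1 => <-; rewrite addrC addKr.
Qed.

Lemma delta1_central : centre R (delta 1).
Proof.
move=> A; apply/eqP; rewrite -subr_eq0; apply/eqP/I_faithful => P IP.
rewrite mulrBl -!mulrA (delta1_comm (I_left A IP)) (delta1_comm IP) mulrA.
by rewrite subrr.
Qed.

(** For P in I, delta(A P) is known; expanding delta(A B P) along
(A B) P and along A (B P) gives the identity multiplied by P on the right. *)
Lemma delta_derivation A B :
  delta (A * B) - A * B * delta 1 =
  A * (delta B - B * delta 1) + (delta A - A * delta 1) * B.
Proof.
apply/eqP; rewrite -subr_eq0; apply/eqP/I_faithful => P IP.
have := delta_mulI (A * B) IP.
rewrite -[A * B * P]mulrA (delta_mulI A (I_left B IP)) (delta_mulI B IP).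
have c1 := delta1_central.
rewrite !mulrA => E.
have {}E : A * delta B * P - A * B * P * delta 1 + delta A * B * P =
    delta (A * B) * P.
  apply: (addrI (A * B * delta P)); apply: (addIr (- (A * B * P * delta 1))).
  by rewrite -E mulrBr mulrDr !mulrA !addrA.
rewrite mulrBl mulrBl mulrDl -E !(mulrBr, mulrBl) -!mulrA.
rewrite (c1 (B * P)) (delta1_comm IP) !mulrA.
set u := A * delta B * P; set v := A * B * P * delta 1; set w := delta A * B * P.
by rewrite [u - v + (w - v)]addrA subrr.
Qed.

End ZeroProducts.

(** * From zero products to derivations *)

Section Projections.
Variables (K : numFieldType) (X : completeNormedModType K).
Hypothesis hK : real_or_complex K.

Lemma bounded_of_closed_graph (T : X -> X) : linear T ->
  (forall y, (forall eta : K, 0 < eta -> exists e, `|e| <= eta /\ `|y - T e| <= eta) ->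
    y = 0) ->
  exists c, forall x, `|T x| <= c * `|x|.
Proof.
move=> Tlin Tcl.
have [C C0 hC] := gauge_closed_graph hK
  (b := norm_gauge hK X) (b' := norm_gauge hK X) Tlin Tcl.
exists C => x; have [->|x0] := eqVneq x 0.
  have T0 : T 0 = 0.
    apply: (addrI (T 0)); rewrite addr0.
    by have := Tlin 1 0 0; rewrite !scale1r addr0.
  by rewrite T0 normr0 mulr0.
by apply: (hC x `|x|); rewrite ?normr_gt0//= .
Qed.

(** Continuity is the closed graph theorem: if e -> 0 and Q e -> y, then y is a
limit of Q e in N and - y is a limit of e - Q e in M. *)
Lemma complemented_projection (N : set X) : closed_subspace N -> complemented N ->
  exists Q : X -> X, [/\ bounded_operator Q, forall x, N (Q x) &
    forall x, N x -> Q x = x].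
Proof.
move=> cN [M [cM NM0 NM]].
have [[subN clN] [subM clM]] := (cN, cM).
have subB (Y : set X) u v : subspace_set Y -> Y u -> Y v -> Y (u - v).
  by move=> [_ Ylin] Yu Yv; rewrite addrC -scaleN1r; apply: Ylin.
have /choice[Q hQ] : forall x, exists y, N y /\ M (x - y).
  by move=> x; have [y [z [Ny Mz ->]]] := NM x; exists y; rewrite [y + z]addrC addrK.
have uniq x y : N y -> M (x - y) -> Q x = y.
  move=> Ny My; have [NQ MQ] := hQ x.
  have : (N `&` M) (Q x - y).
    split; first exact: subB.
    rewrite (_ : Q x - y = (x - y) - (x - Q x)); first exact: subB.
    by rewrite opprB [RHS]addrC addrA subrK.
  by rewrite NM0 /= => /eqP; rewrite subr_eq0 => /eqP.
have Qlin : linear Q.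
  move=> a x y; have [[NQx MQx] [NQy MQy]] := (hQ x, hQ y).
  apply: uniq; first exact: subN.2.
  by rewrite opprD addrACA -scalerBr; apply: subM.2.
exists Q; split; last 2 first.
- by move=> x; have [] := hQ x.
- by move=> x Nx; apply: uniq => //; rewrite subrr; apply: subM.1.
split=> //; apply: bounded_of_closed_graph => // y hy.
have Ny : N y.
  apply: closed_approx => // e e0; have [u [ue yu]] := hy _ (divr_gt0 e0 (ltr0n _ 2)).
  exists (Q u); first by have [] := hQ u.
  by apply: (le_lt_trans yu); rewrite ltr_pdivrMr// ltr_pMr// ltr1n.
have My : M (- y).
  apply: closed_approx => // e e0.
  have e40 : 0 < e / 4 by rewrite divr_gt0.
  have [u [ue yu]] := hy _ e40.
  exists (u - Q u); first by have [] := hQ u.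
  rewrite (_ : - y - (u - Q u) = - (y - Q u) - u); last first.
    by rewrite !opprB addrA [- y + _]addrC.
  apply: (le_lt_trans (ler_normB _ _)); rewrite normrN.
  apply: (le_lt_trans (lerD yu ue)).
  have -> : e / 4 + e / 4 = e / 2 by field.
  by rewrite ltr_pdivrMr// ltr_pMr// ltr1n.
have My' : M y by rewrite -[y]opprK -[- - y]sub0r; apply: subB => //; apply: subM.1.
have : (N `&` M) y by [].
by rewrite NM0.
Qed.

End Projections.

Definition derivation (R : pzRingType) (D : R -> R) :=
  forall S T, D (S * T) = S * D T + D S * T.

Section RankOneBalanced.
Variables (K : numFieldType) (X : completeNormedModType K) (NN : nest X).
Hypothesis hK : real_or_complex K.
Hypothesis hcompl : forall N : set X, NN N -> nest_minus NN N = N -> complemented N.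
Variable delta : {linear nest_alg NN -> nest_alg NN}.
Hypothesis delta0 : zero_product_derivable delta.
Local Notation A := (nest_alg NN).
Local Notation "N ^-" := (nest_minus NN N) (at level 1, format "N ^-").

Lemma mul_scale_alg (a : K) (S T : A) : S * (a *: T) = a *: (S * T).
Proof. by apply: nest_alg_ext => v; rewrite !algE nest_algZ. Qed.

Lemma scale_mul_alg (a : K) (S T : A) : (a *: S) * T = a *: (S * T).
Proof. by apply: nest_alg_ext => v; rewrite !algE. Qed.

Lemma balancedZ (a : K) (P : A) : balanced delta P -> balanced delta (a *: P).
Proof.
move=> bP S T; rewrite mul_scale_alg !scale_mul_alg /= !linearZ /= !mul_scale_alg.
by rewrite !scale_mul_alg -!scalerDr bP.
Qed.

(** Up to a scalar the operator is idempotent. *)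
Lemma balanced_rank_one_ne (x : X) (f : functional X) :
  admissible NN x f -> f x != 0 -> balanced delta (rank_one NN x f).
Proof.
move=> adm fx; have -> : rank_one NN x f = f x *: ((f x)^-1 *: rank_one NN x f).
  by rewrite scalerA mulfV// scale1r.
apply: balancedZ; apply: balanced_idempotent => //; apply: nest_alg_ext => v.
rewrite !algE !rank_oneE// !(functionalZ, scalerA); congr (_ *: _).
by field.
Qed.

(** If N^- = N, then R = x (x) f satisfies Q R = R and R Q = 0 for the
projection Q onto N.  If N^- <> N, take y in N outside N^- and g with
g(y) = 1 vanishing on N^-; then x (x) f = (x (x) g) (y (x) f), and each factor
is a multiple of an idempotent or a corner of the idempotent y (x) g. *)
Lemma balanced_rank_one x (f : functional X) :
  admissible NN x f -> balanced delta (rank_one NN x f).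
Proof.
move=> adm; have [N hN [Nx fN]] := adm.
have [mN|mN] := pselect (N^- = N).
  have cN := nest_closed_subspace hN.
  have [Q0 [Q0b NQ0 Q0N]] := complemented_projection hK cN (hcompl hN mN).
  have Q0P : Q0 \in nest_alg_pred NN.
    apply/nest_alg_predP; split=> // M hM _ [u Mu <-].
    have [MN|NM] := nest_chain hM hN; first by rewrite Q0N//; apply: MN.
    by apply: NM.
  pose Q : A := NestAlg Q0P.
  have QE v : Q v = Q0 v by [].
  apply: (balanced_corner delta0 (P := Q)); apply: nest_alg_ext => v; rewrite !algE !QE.
  - by apply: Q0N.
  - by rewrite rank_oneE// -QE nest_algZ QE Q0N.
  - by rewrite rank_oneE// fN ?scale0r// mN.
have [y Ny nNy] : exists2 y, N y & ~ N^- y.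
  apply: contrapT => ny; apply: mN; apply/seteqP; split; first exact: minus_sub.
  by move=> y Ny; apply: contrapT => nNy; apply: ny; exists y.
have [g gN gy] := closed_subspace_separation hK (nest_closed_subspace (minus_in hN)) nNy.
have admxg : admissible NN x g by exists N.
have admyg : admissible NN y g by exists N.
have admyf : admissible NN y f by exists N.
have E : rank_one NN x f = rank_one NN x g * rank_one NN y f.
  apply: nest_alg_ext => v; rewrite !algE !rank_oneE// functionalZ gy mulr1//.
have yg_id : rank_one NN y g * rank_one NN y g = rank_one NN y g.
  by apply: nest_alg_ext => v; rewrite !algE !rank_oneE// functionalZ gy mulr1.
rewrite E; apply: balancedM.
  have [gx|gx] := eqVneq (g x) 0; last exact: balanced_rank_one_ne.
  apply: (balanced_corner_op delta0 (P := rank_one NN y g)) => //.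
    by apply: nest_alg_ext => v; rewrite !algE !rank_oneE// functionalZ gy mulr1.
  by apply: nest_alg_ext => v; rewrite !algE !rank_oneE// functionalZ gx mulr0 scale0r.
have [fy|fy] := eqVneq (f y) 0; last exact: balanced_rank_one_ne.
apply: (balanced_corner delta0 (P := rank_one NN y g)) => //.
  by apply: nest_alg_ext => v; rewrite !algE !rank_oneE// functionalZ gy mulr1.
by apply: nest_alg_ext => v; rewrite !algE !rank_oneE// functionalZ fy mulr0 scale0r.
Qed.

Definition rank_one_op (P : A) :=
  exists x (f : functional X), admissible NN x f /\ P = rank_one NN x f.

Lemma rank_one_op_left S P : rank_one_op P -> rank_one_op (S * P).
Proof.
move=> [x [f [adm ->]]]; have [N hN [Nx fN]] := adm.
have admS : admissible NN (S x) f by exists N => //; split=> //; apply: nest_alg_inv.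
exists (S x), f; split=> //; apply: nest_alg_ext => v.
by rewrite !algE !rank_oneE// nest_algZ.
Qed.

Lemma core_rank_one x : core NN x -> exists f y, admissible NN x f /\ f y = 1.
Proof.
move=> [N [hN [y Ny] Nx]].
have [f fN fy] := closed_subspace_separation hK (nest_closed_subspace (minus_in hN)) Ny.
by exists f, y; split=> //; exists N.
Qed.

Hypothesis X0 : exists x : X, x != 0.

Lemma dense_eq0 (F : X -> X) (c : K) : {morph F : x y / x - y} ->
  (forall x, `|F x| <= c * `|x|) -> (forall x, core NN x -> F x = 0) ->
  forall x, F x = 0.
Proof.
move=> FB Fc F0 x; have [{Fc}c c0 Fc] := bound_ge0 (ex_intro _ c Fc).
apply/eqP; rewrite -normr_eq0 eq_le normr_ge0 andbT.
apply: le_of_le_eps => [||e e0]; rewrite ?normr_real ?real0// add0r.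
have [z Xz xz] := core_dense NN X0 x (divr_gt0 e0 c0).
rewrite -[F x]subr0 -(F0 z)// -FB; apply: (le_trans (Fc _)).
by rewrite mulrC -ler_pdivlMr//; exact: ltW.
Qed.

Lemma alg_ext_core (S T : A) : (forall x, core NN x -> S x = T x) -> S = T.
Proof.
move=> ST; apply: nest_alg_ext => v; apply/eqP; rewrite -subr_eq0; apply/eqP.
have [c _ hc] := nest_alg_bound (S - T).
apply: (@dense_eq0 (S - T) c) => // [x y|x /ST /= STx]; first by rewrite nest_algB.
by rewrite -[LHS]/(S x - T x) STx subrr.
Qed.

Lemma rank_one_faithful S : (forall P, rank_one_op P -> S * P = 0) -> S = 0.
Proof.
move=> h; apply: alg_ext_core => x /core_rank_one[f [y [adm fy]]].
have /(congr1 (fun T : A => T y)) : S * rank_one NN x f = 0.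
  by apply: h; exists x, f.
by rewrite !algE rank_oneE// fy scale1r.
Qed.

Lemma zero_product_derivation : centre A (delta 1) /\
  derivation (fun S => delta S - S * delta 1).
Proof.
have Ib P : rank_one_op P -> balanced delta P.
  by move=> [x [f [adm ->]]]; apply: balanced_rank_one.
split; first exact: delta1_central Ib rank_one_op_left rank_one_faithful.
by move=> S T; apply: delta_derivation Ib rank_one_op_left rank_one_faithful _ _.
Qed.

End RankOneBalanced.

(** * Continuity of derivations *)

Section NestAlgebraGauge.
Variables (K : numFieldType) (X : completeNormedModType K) (NN : nest X).
Hypothesis hK : real_or_complex K.

Lemma nest_alg_complete (s : nat -> nest_alg NN) (rho : nat -> K) :
  (forall k, 0 < rho k) -> (forall k, rho k.+1 <= rho k / 2) ->
  (forall k v, `|(s k.+1 - s k) v| <= rho k / 2 * `|v|) ->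
  exists l : nest_alg NN, forall k v, `|(l - s k) v| <= rho k * `|v|.
Proof.
move=> rho0 rhoS sS.
have /choice[l hl] : forall v, exists l, forall k, `|l - s k v| <= rho k * `|v|.
  by move=> v; apply: norm_complete => // k; apply: sS.
suff lP : l \in nest_alg_pred NN by exists (NestAlg lP) => k v; apply: hl.
apply/nest_alg_predP; split; first split.
- move=> a x y; apply/eqP; rewrite -subr_eq0; apply/eqP.
  apply: (eq0_of_halving hK (rho := rho) (D := `|a *: x + y| + (`|a| * `|x| + `|y|))) => // k.
  have -> : l (a *: x + y) - (a *: l x + l y) =
      (l (a *: x + y) - s k (a *: x + y)) - (a *: (l x - s k x) + (l y - s k y)).
    rewrite nest_algD nest_algZ scalerBr [a *: l x - _ + _]addrACA -opprD.
    by rewrite [in RHS]opprB addrA subrK.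
  apply: (le_trans (ler_normB _ _)); rewrite mulrDr lerD// mulrDr.
  apply: (le_trans (ler_normD _ _)); rewrite lerD//.
  by rewrite normrZ mulrCA ler_wpM2l.
- have [c c0 hc] := nest_alg_bound (s 0%N).
  exists (rho 0%N + c) => v; rewrite -(subrK (s 0%N v) (l v)).
  by apply: (le_trans (ler_normD _ _)); rewrite mulrDl lerD.
- move=> N hN _ [v Nv <-]; apply: closed_approx (nest_closed_subspace hN).2 _ => e e0.
  have [k /(_ _ (leqnn k)) hk] := halving_small hK rho0 rhoS (normr_ge0 v) e0.
  exists (s k v); first exact: nest_alg_inv.
  exact: le_lt_trans (hl v k) hk.
Qed.

Definition nest_alg_gauge : gauge (nest_alg NN).
Proof.
apply: (@Gauge K (nest_alg NN) (fun S c => forall v, `|S v| <= c * `|v|)).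
- exact: nest_alg_bound.
- by move=> a S c hS v; rewrite algE normrZ -mulrA ler_wpM2l.
- move=> S T c d hS hT v; rewrite algE mulrDl.
  by apply: (le_trans (ler_normD _ _)); rewrite lerD.
- by move=> S c d cd hS v; apply: (le_trans (hS v)); rewrite ler_wpM2r.
- exact: nest_alg_complete.
Defined.

End NestAlgebraGauge.

Section ContinuousDerivation.
Variables (K : numFieldType) (X : completeNormedModType K) (NN : nest X).
Hypothesis hK : real_or_complex K.
Hypothesis X0 : exists x : X, x != 0.
Local Notation A := (nest_alg NN).
Local Notation "N ^-" := (nest_minus NN N) (at level 1, format "N ^-").
Variable D : A -> A.
Hypotheses (Dlin : linear D) (Dder : derivation D).

(** Closedness of the graph: let S -> 0 and D(S) -> T.  With R = x (x) f,
f(y) = 1 and R' = z (x) g, the product rule for R' S R = g(S x) (z (x) f)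
expresses g(D(S) x) z through S alone, and continuously; hence g(T x) = 0 for
all x in the core and all g from a total set. *)
Lemma derivation_continuous : exists2 C : K, 0 < C &
  forall (S : A) c, 0 < c -> (forall v, `|S v| <= c * `|v|) ->
  forall v, `|D S v| <= C * c * `|v|.
Proof.
have [|C C0 hC] := gauge_closed_graph hK (b := nest_alg_gauge NN hK)
    (b' := nest_alg_gauge NN hK) Dlin; last first.
  by exists C => // S c c0 hS; apply: (hC S c c0 hS).
move=> T hT; apply: (alg_ext_core X0) => x cx.
have [N [hN Nm Nx]] := cx.
have [f [y [adm fy]]] : exists (f : functional X) y, kills f N^- /\ f y = 1.
  have [y Ny] := Nm.
  have [f fN fy] := closed_subspace_separation hK (nest_closed_subspace (minus_in hN)) Ny.
  by exists f, y.
have admx : admissible NN x f by exists N.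
rewrite algE; apply: (functionals_total hK (NN := NN)) => g L hL [z Lz z0] gL.
(* z (x) f is admissible when L is contained in N; otherwise T x, which lies in
   N, is killed by g. *)
have [NL|LN] := nest_sub_or_proper hN hL; last first.
  by apply: gL; apply: (proper_sub_minus hN LN); apply: nest_alg_inv.
have admzg : admissible NN z g by exists L.
have admzf : admissible NN z f by exists N => //; split=> //; apply: NL.
have D_eq (S : A) : g (D S x) *: z =
    g (S x) *: D (rank_one NN z f) y - g (S (D (rank_one NN x f) y)) *: z
    - D (rank_one NN z g) (S x).
  have E : rank_one NN z g * (S * rank_one NN x f) = g (S x) *: rank_one NN z f.
    apply: nest_alg_ext => v; rewrite !algE !rank_oneE// nest_algZ functionalZ.
    by rewrite scalerA mulrC.
  have DZ a U : D (a *: U) = a *: D U.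
    have D0 : D 0 = 0.
      apply: (addrI (D 0)); rewrite addr0.
      by have := Dlin 1 0 0; rewrite !scale1r addr0.
    by have := Dlin a U 0; rewrite D0 !addr0.
  have := congr1 (fun U : A => U y) (Dder (rank_one NN z g) (S * rank_one NN x f)).
  rewrite E DZ Dder !algE nest_algD !rank_oneE// fy scale1r => ->.
  by rewrite [RHS]addrAC addrK addrAC subrr add0r.
have [cg cg0 hg] := bound_ge0 (functional_bounded g).
have [cz cz0 hz] := nest_alg_bound (D (rank_one NN z g)).
set p := D (rank_one NN z f) y in D_eq; set q := D (rank_one NN x f) y in D_eq.
(* |g (T x)| |z| <= eta * B whenever |S| <= eta and |T - D S| <= eta *)
pose B := cg * `|x| * `|p| + cg * `|q| * `|z| + cz * `|x| + cg * `|x| * `|z|.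
have B0 : 0 <= B by rewrite /B !(addr_ge0, mulr_ge0)// ltW.
suff : g (T x) *: z = 0 by move/eqP; rewrite scaler_eq0 (negbTE z0) orbF => /eqP.
apply/eqP; rewrite -normr_eq0 eq_le normr_ge0 andbT.
apply: le_of_le_eps => [||e e0]; rewrite ?normr_real ?real0// add0r.
have B10 : 0 < B + 1 by rewrite ltr_wpDl.
have eta0 : 0 < e / (B + 1) by rewrite divr_gt0.
set eta := e / (B + 1) in eta0.
have [S [/= hS hTS]] := hT _ eta0.
have gS u : `|g (S u)| <= eta * (cg * `|u|).
  by apply: (le_trans (hg _)); rewrite mulrCA ler_wpM2l// ltW.
apply: (@le_trans _ _ (eta * B)); last first.
  rewrite /eta mulrAC ler_pdivrMr// ler_wpM2l ?(ltW e0)//.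
  by rewrite lerDl.
have -> : g (T x) *: z = g (D S x) *: z + g ((T - D S) x) *: z.
  by rewrite !algE functionalB scalerBl addrC subrK.
rewrite D_eq /B !mulrDr.
apply: (le_trans (ler_normD _ _)); apply: lerD.
  apply: (le_trans (ler_normB _ _)); apply: lerD.
    apply: (le_trans (ler_normB _ _)); rewrite !normrZ; apply: lerD.
      by rewrite mulrA ler_wpM2r.
    by rewrite mulrA ler_wpM2r.
  by apply: (le_trans (hz _)); rewrite mulrCA ler_wpM2l// ltW.
rewrite normrZ mulrA ler_wpM2r//; apply: (le_trans (hg _)).
by rewrite mulrCA ler_wpM2l ?(ltW cg0)//; apply: hTS.
Qed.

End ContinuousDerivation.

(** * Derivations are inner *)

Lemma subrACA (V : zmodType) (a b c d : V) : (a - b) - (c - d) = (a - c) - (b - d).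
Proof. by rewrite [in LHS]opprD addrACA -opprD. Qed.

Section Extension.
Variables (K : numFieldType) (X : completeNormedModType K).
Hypothesis hK : real_or_complex K.

(** The extension is the closure of the graph of S: [P x w] says that (x, w) is
a limit of points (u, S u) with u in Y. *)
Lemma dense_extension (Y : set X) (S : X -> X) (B : K) : subspace_set Y ->
  (forall x (e : K), 0 < e -> exists2 z, Y z & `|x - z| < e) ->
  (forall a x y, Y x -> Y y -> S (a *: x + y) = a *: S x + S y) ->
  0 < B -> (forall x, Y x -> `|S x| <= B * `|x|) ->
  exists T : X -> X, [/\ linear T, forall x, `|T x| <= B * `|x| &
    forall x, Y x -> T x = S x].
Proof.
move=> [Y0 Ylin] Yd Slin B0 SB.
pose P x w := forall e : K, 0 < e -> exists u, [/\ Y u, `|x - u| < e & `|w - S u| < e].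
have P_ex x : exists w, P x w.
  pose rho k : K := 2^-1 ^+ k.
  have rho0 k : 0 < rho k by rewrite exprn_gt0// invr_gt0.
  have rhoS k : rho k.+1 = rho k / 2 by rewrite /rho exprSr.
  have /choice[u hu] : forall k, exists u, Y u /\ `|x - u| < rho k / 4.
    move=> k; have [|u Yu xu] := Yd x (rho k / 4); first by rewrite divr_gt0.
    by exists u.
  have SS v w : Y v -> Y w -> S v - S w = S (v - w).
    by move=> Yv Yw; rewrite [v - w]addrC -[- w]scaleN1r Slin// scaleN1r addrC.
  have YB v w : Y v -> Y w -> Y (v - w).
    by move=> Yv Yw; rewrite addrC -scaleN1r; apply: Ylin.
  have [| |l hl] := norm_complete hK (s := fun k => S (u k)) (ltW B0) rho0.
  - by move=> k; rewrite rhoS.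
  - move=> k; have [[Yk xk] [Yk1 xk1]] := (hu k, hu k.+1).
    rewrite SS//; apply: (le_trans (SB _ (YB _ _ Yk1 Yk))).
    rewrite mulrC ler_wpM2r ?(ltW B0)//.
    have -> : u k.+1 - u k = (x - u k) - (x - u k.+1).
      by rewrite opprB [RHS]addrC addrA subrK.
    apply: (le_trans (ler_normB _ _)).
    have -> : rho k / 2 = rho k / 4 + rho k / 4 by field.
    apply: lerD; first exact: ltW.
    apply: (le_trans (ltW xk1)); rewrite rhoS ler_wpM2r ?invr_ge0//.
    by rewrite ler_pdivrMr// ler_peMr ?ler1n ?(ltW (rho0 _)).
  exists l => e e0.
  have rhoS' k : rho k.+1 <= rho k / 2 by rewrite rhoS.
  have [k1 h1] := halving_small hK rho0 rhoS' (ltW B0) e0.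
  have [k2 h2] := halving_small hK rho0 rhoS' ler01 e0.
  pose k := maxn k1 k2; exists (u k); have [Yk xk] := hu k; split=> //.
    apply: (lt_trans xk); apply: le_lt_trans (h2 k (leq_maxr _ _)).
    by rewrite ler_wpM2l ?(ltW (rho0 _))// invf_le1// ler1n.
  by apply: (le_lt_trans (hl k)); apply: h1; apply: leq_maxl.
have P_lin a x y v w : P x v -> P y w -> P (a *: x + y) (a *: v + w).
  move=> Px Py e e0.
  have a0 : 0 < `|a| + 1 by rewrite ltr_wpDl.
  have e20 : 0 < e / 2 by rewrite divr_gt0.
  have [u [Yu xu vu]] := Px _ (divr_gt0 e20 a0).
  have [t [Yt yt wt]] := Py _ e20.
  have split_bound (x1 x2 y1 y2 : X) : `|x1 - y1| < e / 2 / (`|a| + 1) ->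
      `|x2 - y2| < e / 2 -> `|a *: x1 + x2 - (a *: y1 + y2)| < e.
    move=> h1 h2; rewrite opprD addrACA -scalerBr.
    apply: (le_lt_trans (ler_normD _ _)); rewrite [e]splitr; apply: ler_ltD => //.
    rewrite normrZ; apply: (@le_trans _ _ ((`|a| + 1) * `|x1 - y1|)).
      by rewrite ler_wpM2r// lerDl.
    by rewrite mulrC -ler_pdivlMr// ltW.
  exists (a *: u + t); split; first exact: Ylin.
    exact: split_bound.
  by rewrite Slin//; apply: split_bound.
have P_bound x w : P x w -> `|w| <= B * `|x|.
  move=> Px; apply: le_of_le_eps => [||e e0].
  - exact: normr_real.
  - by rewrite ger0_real// mulr_ge0// ltW.
  have B1 : 0 < B + 1 by rewrite ltr_wpDl// ltW.
  have [u [Yu xu wu]] := Px _ (divr_gt0 e0 B1).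
  rewrite -(subrK (S u) w); apply: (le_trans (ler_normD _ _)).
  apply: (@le_trans _ _ (e / (B + 1) + B * (`|x| + e / (B + 1)))).
    apply: lerD; first exact: ltW.
    apply: (le_trans (SB _ Yu)); rewrite ler_wpM2l ?(ltW B0)//.
    rewrite -[u](subKr x); apply: (le_trans (ler_normB _ _)).
    by rewrite lerD2l ltW.
  rewrite le_eqVlt; apply/orP; left; apply/eqP; field.
  by rewrite gt_eqF.
have P_uniq x v w : P x v -> P x w -> v = w.
  move=> Pv Pw; have := P_bound _ _ (P_lin (-1) _ _ _ _ Pw Pv).
  rewrite !scaleN1r addNr normr0 mulr0 normr_le0 addrC subr_eq0.
  by move/eqP.
have [T PT] := choice P_ex.
exists T; split.
- by move=> a x y; apply: (P_uniq (a *: x + y)) => //; apply: P_lin.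
- by move=> x; apply: P_bound.
- move=> x Yx; apply: (P_uniq x) => // e e0.
  by exists x; rewrite !subrr normr0.
Qed.

End Extension.

Section InnerDerivation.
Variables (K : numFieldType) (X : completeNormedModType K) (NN : nest X).
Hypothesis hK : real_or_complex K.
Hypothesis X0 : exists x : X, x != 0.
Local Notation A := (nest_alg NN).
Local Notation "N ^-" := (nest_minus NN N) (at level 1, format "N ^-").
Variable D : A -> A.
Hypotheses (Dlin : linear D) (Dder : derivation D).

(** If D(T) = S T - T S, then slice f y x = f(y) S x - f(S y) x: with f(y) = 1
it recovers S up to a scalar. *)
Let slice (f : functional X) (y x : X) : X := D (rank_one NN x f) y.

Lemma slice_lin N f y a x z : NN N -> kills f N^- -> N x -> N z ->
  slice f y (a *: x + z) = a *: slice f y x + slice f y z.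
Proof.
move=> hN fN Nx Nz; rewrite /slice.
have Nxz : N (a *: x + z) by apply: (nest_closed_subspace hN).1.2.
have -> : rank_one NN (a *: x + z) f = a *: rank_one NN x f + rank_one NN z f.
  apply: nest_alg_ext => v; rewrite !algE !rank_oneE; try by exists N.
  by rewrite scalerDr !scalerA mulrC.
by rewrite Dlin !algE.
Qed.

Lemma slice_module N f y (T : A) x : NN N -> kills f N^- -> f y = 1 -> N x ->
  slice f y (T x) = T (slice f y x) + D T x.
Proof.
move=> hN fN fy Nx; rewrite /slice.
have ax : admissible NN x f by exists N.
have aTx : admissible NN (T x) f by exists N => //; split=> //; apply: nest_alg_inv.
have -> : rank_one NN (T x) f = T * rank_one NN x f.
  by apply: nest_alg_ext => v; rewrite !algE !rank_oneE// nest_algZ.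
by rewrite Dder !algE rank_oneE// fy scale1r.
Qed.

(** Commutation with z (x) g reads g(x) E(z) = g(E(x)) z.  A functional g1 with
g1(x1) <> 0 makes E the scalar mu on a small member; since any other g can be
tested on a nonzero z of a member smaller still, g(E(x)) = mu g(x) for all x in
N and all g of a total set. *)
Lemma commuting_scalar N (E : X -> X) x1 : NN N -> N x1 -> x1 != 0 ->
  (forall a x, N x -> E (a *: x) = a *: E x) ->
  (forall (T : A) x, N x -> E (T x) = T (E x)) ->
  exists mu, forall x, N x -> E x = mu *: x.
Proof.
move=> hN Nx1 x10 EZ ET.
have swap (g : functional X) L z x : NN L -> kills g L^- -> L z -> N z -> N x ->
    g x *: E z = g (E x) *: z.
  move=> hL gL Lz Nz Nx; have adm : admissible NN z g by exists L.
  by rewrite -EZ// -!(rank_oneE _ adm) ET.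
have common L M : NN L -> NN M -> (exists2 z, L z & z != 0) ->
    (exists2 z, M z & z != 0) ->
    exists2 P, NN P /\ P `<=` L `&` M & exists2 z, P z & z != 0.
  move=> hL hM Lz Mz; have [LM|ML] := nest_chain hL hM.
    by exists L => //; split=> // u Lu; split=> //; apply: LM.
  by exists M => //; split=> // u Mu; split=> //; apply: ML.
have nz1 : exists2 z, N z & z != 0 by exists x1.
have [g1 [L1 [hL1 nzL1 g1L1 g1x1]]] : exists (g : functional X) L,
    [/\ NN L, exists2 z, L z & z != 0, kills g L^- & g x1 != 0].
  apply: contrapT => ng; move/eqP: x10; apply.
  apply: (functionals_total hK (NN := NN)) => g L hL nzL gL.
  by apply/eqP/negPn/negP => gx; apply: ng; exists g, L.
pose mu := g1 (E x1) / g1 x1.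
exists mu => x Nx; apply/eqP; rewrite -subr_eq0; apply/eqP.
apply: (functionals_total hK (NN := NN)) => g L hL nzL gL.
have [P [hP PLL1] nzP] := common _ _ hL hL1 nzL nzL1.
have [Q [hQ QPN] [z Qz z0]] := common _ _ hP hN nzP nz1.
have [Pz Nz] := QPN _ Qz; have [Lz L1z] := PLL1 _ Pz.
have Ez : E z = mu *: z.
  have := swap g1 L1 z x1 hL1 g1L1 L1z Nz Nx1.
  move=> /(congr1 (fun v => (g1 x1)^-1 *: v)); rewrite !scalerA mulVf// scale1r => ->.
  by rewrite mulrC.
have := swap g L z x hL gL Lz Nz Nx; rewrite Ez scalerA => /eqP.
rewrite -subr_eq0 -scalerBl scaler_eq0 (negbTE z0) orbF => /eqP gx.
by rewrite functionalB functionalZ mulrC -opprB gx oppr0.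
Qed.

(** Let z be in M, and suppose S z is not in L^- for some L strictly above M.
Take f vanishing on L^- with f(S z) = 1 and y in L outside M.  As f(z) = 0,
D(y (x) f) z = - y, which is not in M: a contradiction.  Hence S z is in L^- for
all such L, and [mem_of_minus] applies. *)
Lemma commutator_invariant (S : X -> X) : linear S ->
  (forall (T : A) x, D T x = S (T x) - T (S x)) ->
  forall M, NN M -> S @` M `<=` M.
Proof.
move=> Slin DS M hM _ [z Mz <-]; apply: (mem_of_minus hM) => L hL ML.
apply: contrapT => nLz.
have [f fL fz] := closed_subspace_separation hK (nest_closed_subspace (minus_in hL)) nLz.
have [_ nLM] := ML.
have [y Ly nMy] : exists2 y, L y & ~ M y.
  apply: contrapT => ny; apply: nLM => y Ly.
  by apply: contrapT => nMy; apply: ny; exists y.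
have adm : admissible NN y f by exists L.
have S0 : S 0 = 0.
  by apply: (addrI (S 0)); have := Slin 1 0 0; rewrite !scale1r !addr0.
apply: nMy; have := nest_alg_inv (D (rank_one NN y f)) hM Mz.
rewrite DS !rank_oneE// fz scale1r (fL z) ?scale0r ?S0 ?sub0r; last first.
  exact: (proper_sub_minus hM ML).
move=> /((nest_closed_subspace hM).1.2 (-1) _ 0) /(_ (nest_closed_subspace hM).1.1).
by rewrite scaleN1r addr0 opprK.
Qed.

(** The maps [slice f y] on different members, normalised by h(S x1) = 0,
agree by [commuting_scalar] and glue to a map on the core. *)
Lemma core_commutator : exists (S : X -> X) (B : K),
  [/\ 0 < B, forall a x y, core NN x -> core NN y -> S (a *: x + y) = a *: S x + S y,
      forall x, core NN x -> `|S x| <= B * `|x| &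
      forall (T : A) x, core NN x -> S (T x) = T (S x) + D T x].
Proof.
have [C C0 hC] := derivation_continuous hK X0 Dlin Dder.
have [x1 cx1 x10] : exists2 x1, core NN x1 & x1 != 0.
  have [x0 x00] := X0; have [|z cz xz] := core_dense NN X0 x0 (e := `|x0|).
    by rewrite normr_gt0.
  by exists z => //; apply: contraTneq xz => ->; rewrite subr0 ltxx.
have [h _ hx1] : exists2 h : functional X, kills h [set 0] & h x1 = 1.
  apply: (closed_subspace_separation hK (nest_closed_subspace (nest_zero NN))).
  by apply/eqP.
(* 4 is the constant of the Riesz lemma; it makes the bounds independent of N *)
pose good (f : functional X) y N := [/\ NN N, N x1, kills f N^-, f y = 1 &
  forall x, `|f x| * `|y| <= 4 * `|x|].
have good_ex x z : core NN x -> core NN z -> exists f y N, [/\ good f y N, N x & N z].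
  move=> cx cz; have [N [hN Nm Nx Nz]] := core_pair cx cz.
  have cN u : N u -> core NN u by exists N.
  have [M [hM Mm [Mx Mz Mx1]]] : exists M,
      [/\ NN M, exists y, ~ M^- y & [/\ M x, M z & M x1]].
    have [M [hM Mm Mx1]] := cx1.
    by have [NM|MN] := nest_chain hN hM; [exists M|exists N]; split=> //; split=> //;
      [apply: NM|apply: NM|apply: MN].
  have [f [y [fM fy fb]]] := riesz_functional hK (nest_closed_subspace (minus_in hM)) Mm.
  by exists f, y, M.
pose W f y x := slice f y x - h (slice f y x1) *: x.
have W_lin f y N a x z : good f y N -> N x -> N z ->
    W f y (a *: x + z) = a *: W f y x + W f y z.
  move=> [hN _ fN _ _] Nx Nz; rewrite /W (slice_lin _ _ hN)//.
  by rewrite !scalerDr opprD addrACA !scalerN !scalerA mulrC.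
have W_module f y N (T : A) x : good f y N -> N x -> W f y (T x) = T (W f y x) + D T x.
  move=> [hN _ fN fy _] Nx; rewrite /W (slice_module _ hN)// nest_algB nest_algZ.
  by rewrite addrAC.
have W_h f y : h (W f y x1) = 0 by rewrite /W functionalB functionalZ hx1 mulr1 subrr.
have W_uniq f y N f' y' N' x : good f y N -> good f' y' N' -> N x -> N' x ->
    W f y x = W f' y' x.
  move=> gN gN' Nx N'x.
  have [P [hP PN PN' Px Px1]] : exists P, [/\ NN P, P `<=` N, P `<=` N', P x & P x1].
    have [hN Nx1 _ _ _] := gN; have [hN' N'x1 _ _ _] := gN'.
    by have [NN'|N'N] := nest_chain hN hN'; [exists N|exists N']; split.
  have W0 f0 y0 N0 : good f0 y0 N0 -> W f0 y0 0 = 0.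
    move=> g0; have [hN0 _ _ _ _] := g0; have z0 := (nest_closed_subspace hN0).1.1.
    apply: (addrI (W f0 y0 0)); have := W_lin _ _ _ 1 0 0 g0 z0 z0.
    by rewrite !scale1r !addr0 => <-.
  have W_Z f0 y0 N0 a u : good f0 y0 N0 -> N0 u -> W f0 y0 (a *: u) = a *: W f0 y0 u.
    move=> g0 Nu; have [hN0 _ _ _ _] := g0; have z0 := (nest_closed_subspace hN0).1.1.
    by have := W_lin _ _ _ a u 0 g0 Nu z0; rewrite (W0 _ _ _ g0) !addr0.
  have [a u Pu|T u Pu|mu hmu] := 
    commuting_scalar (E := fun u => W f y u - W f' y' u) hP Px1 x10.
  - rewrite (W_Z _ _ _ _ _ gN (PN _ Pu)) (W_Z _ _ _ _ _ gN' (PN' _ Pu)).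
    exact: esym (scalerBr _ _ _).
  - rewrite (W_module _ _ _ _ _ gN (PN _ Pu)) (W_module _ _ _ _ _ gN' (PN' _ Pu)).
    by rewrite opprD addrACA subrr addr0; exact: esym (nest_algB _ _ _).
  have := congr1 h (hmu _ Px1); rewrite functionalB !W_h subrr functionalZ hx1 mulr1.
  by move=> mu0; apply/eqP; rewrite -subr_eq0 hmu// -mu0 scale0r.
have [S hS] : exists S, forall x, core NN x ->
    forall f y N, good f y N -> N x -> S x = W f y x.
  suff /choice[S hS] : forall x, exists w, core NN x ->
      forall f y N, good f y N -> N x -> w = W f y x.
    by exists S.
  move=> x; have [cx|ncx] := pselect (core NN x); last by exists 0.
  have [f [y [N [g Nx _]]]] := good_ex _ _ cx cx.
  by exists (W f y x) => _ f' y' N' g' N'x; apply: W_uniq g g' Nx N'x.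
have slice_bound f y N x : good f y N -> N x -> `|slice f y x| <= C * 4 * `|x|.
  move=> [hN _ fN fy fb] Nx.
  have y0 : 0 < `|y|.
    rewrite normr_gt0; apply/eqP => y0; move: fy; rewrite y0 functional0.
    by move/eqP; rewrite eq_sym oner_eq0.
  have adm : admissible NN x f by exists N.
  have [->|x0] := eqVneq x 0.
    have := slice_lin y 0 hN fN Nx Nx.
    have N0 := (nest_closed_subspace hN).1.1.
    have := slice_lin y 1 hN fN N0 N0; rewrite !scale1r addr0.
    move=> /(congr1 (fun v => v - slice f y 0)); rewrite subrr addrK => <- _.
    by rewrite !normr0 mulr0.
  have := hC (rank_one NN x f) (4 * `|x| / `|y|) _ _ y.
  rewrite /slice (_ : C * (4 * `|x| / `|y|) * `|y| = C * 4 * `|x|); last first.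
    by field; rewrite gt_eqF.
  apply; first by rewrite divr_gt0// mulr_gt0// normr_gt0.
  move=> v; rewrite rank_oneE// normrZ mulrAC mulrAC.
  rewrite [X in _ <= X]mulrAC ler_pdivlMr//.
  by rewrite mulrAC [X in _ <= X]mulrAC ler_wpM2r.
have [c c0 hc] := bound_ge0 (functional_bounded h).
exists S, (C * 4 + c * (C * 4 * `|x1|) + 1); split.
- by rewrite ltr_wpDl// addr_ge0// ?mulr_ge0// ltW.
- move=> a x z cx cz; have [f [y [N [g Nx Nz]]]] := good_ex _ _ cx cz.
  have cxz : core NN (a *: x + z) by apply: (core_subspace NN X0).2.
  have [hN _ _ _ _] := g.
  rewrite (hS _ cxz _ _ _ g); last exact: (nest_closed_subspace hN).1.2.
  by rewrite (hS _ cx _ _ _ g)// (hS _ cz _ _ _ g)// (W_lin _ _ _ _ _ _ g).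
- move=> x cx; have [f [y [N [g Nx _]]]] := good_ex _ _ cx cx.
  rewrite (hS _ cx _ _ _ g)//; have [_ Nx1 _ _ _] := g.
  apply: (@le_trans _ _ ((C * 4 + c * (C * 4 * `|x1|)) * `|x|)); last first.
    by rewrite ler_wpM2r// lerDl.
  rewrite mulrDl; apply: (le_trans (ler_normB _ _)); apply: lerD.
    exact: slice_bound g Nx.
  rewrite normrZ ler_wpM2r//; apply: (le_trans (hc _)).
  by rewrite ler_wpM2l ?(ltW c0)//; apply: slice_bound g Nx1.
- move=> T x cx; have [f [y [N [g Nx _]]]] := good_ex _ _ cx cx.
  have [hN _ _ _ _] := g.
  have NTx : N (T x) by apply: nest_alg_inv.
  have cTx : core NN (T x).
    have [M [hM Mm Mx]] := cx; exists M; split=> //; exact: nest_alg_inv.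
  by rewrite (hS _ cTx _ _ _ g)// (hS _ cx _ _ _ g)// (W_module _ _ _ _ _ g).
Qed.

(** The identity D(T) = S T - T S holds on the core and extends by continuity;
[commutator_invariant] then places S in the algebra. *)
Theorem derivation_inner : exists S : A, forall T : A, D T = S * T - T * S.
Proof.
have [S0 [B [B0 S0lin S0B S0D]]] := core_commutator.
have [S [Slin SB SS0]] := dense_extension hK (core_subspace NN X0)
  (core_dense NN X0) S0lin B0 S0B.
have SBB x y : S (x - y) = S x - S y.
  by rewrite addrC -scaleN1r Slin scaleN1r addrC.
have DS (T : A) x : D T x = S (T x) - T (S x).
  apply/eqP; rewrite -subr_eq0; apply/eqP; move: x.
  have [c c0 hc] := nest_alg_bound T.
  have [d d0 hd] := nest_alg_bound (D T).
  apply: (dense_eq0 X0 (NN := NN) (c := d + (B * c + c * B))).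
  - move=> x y; rewrite !nest_algB !SBB nest_algB [RHS]subrACA.
    by congr (_ - _); apply: subrACA.
  - move=> x; apply: (le_trans (ler_normB _ _)); rewrite mulrDl lerD//.
    apply: (le_trans (ler_normB _ _)); rewrite mulrDl -!mulrA lerD//.
      by apply: (le_trans (SB _)); rewrite ler_wpM2l// ltW.
    by apply: (le_trans (hc _)); rewrite ler_wpM2l// ltW.
  - move=> x cx; have cTx : core NN (T x).
      have [M [hM Mm Mx]] := cx; exists M; split=> //; exact: nest_alg_inv.
    by rewrite !SS0// S0D// addrAC subrr add0r subrr.
suff SP : S \in nest_alg_pred NN.
  by exists (NestAlg SP) => T; apply: nest_alg_ext => v; rewrite DS.
apply/nest_alg_predP; split; first by split=> //; exists B.
exact: commutator_invariant DS.
Qed.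

End InnerDerivation.

Theorem corollary3p2 (K : numFieldType) (hK : real_or_complex K)
    (X : completeNormedModType K) (hdim : dim_ge2 X)
    (NN : nest X)
    (hcompl : forall N : set X, NN N -> nest_minus NN N = N -> complemented N)
    (delta : {linear nest_alg NN -> nest_alg NN}) :
  (forall A B : nest_alg NN, A * B = 0 -> A * delta B + delta A * B = 0) <->
  (exists S T : nest_alg NN,
     (forall A : nest_alg NN, delta A = A * T - S * A) /\
     centre (nest_alg NN) (T - S)).
Proof.
split=> [delta0|[S [T [deltaE TS]]] A B AB]; last first.
  rewrite !deltaE mulrBr mulrBl !mulrA AB mul0r sub0r -[S * A * B]mulrA AB mulr0 subr0.
  rewrite addrC -mulrBl -mulrBr -TS -mulrA AB mulr0 //.
have X0 : exists x : X, x != 0.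
  have [x [y xy]] := hdim; exists x; apply/eqP => x0.
  have /= := xy 1 0; rewrite x0 scaler0 scale0r addr0 => /(_ erefl)[/eqP].
  by rewrite oner_eq0.
have [c1 der] := zero_product_derivation hK hcompl delta0 X0.
have [|S hS] := derivation_inner hK X0 _ der.
  move=> a A B; rewrite linearP mulrDl scale_mul_alg scalerBr opprD.
  by rewrite addrACA.
exists (- S), (delta 1 - S); split=> [A|]; last first.
  by rewrite opprK subrK.
rewrite mulrBr mulNr opprK -addrA [- _ + _]addrC -hS addrC subrK //.
Qed.
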